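(* Every Boolean algebra $(B_{oole},\cap,\cup,\sim,\bot,\top)$ has a Bayesian extension $(B_{ayes},\cap,\cup,\sim,\bot,\top,[\;])$ with $|B_{ayes}|=\max\{|B_{oole}|,|\mathbb{N}|\}$.
   Context: An ordered field is denoted $\mathbb{K}$. A $\mathbb{K}$-probability distribution on a Boolean algebra $E$ is a map $P:E\to\mathbb{K}$ with $P\ge0$, $P(\bot)=0$, $P(\top)=1$ and $P(x\cap y)+P(x\cup y)=P(x)+P(y)$ for all $x,y\in E$. A Bayesian algebra is a septuple $(E,\cap,\cup,\sim,\bot,\top,[\;])$ where $(E,\cap,\cup,\sim,\bot,\top)$ is a Boolean algebra and $[\;]:E\times E\to E$, $(x,y)\mapsto[x]y$, satisfies for all $x,y\in E$: $z\mapsto[x]z$ is a Boolean automorphism of $E$; $x\subset y$ implies $[x]y=\top$ or $x=\bot$; $x\cap[x]y=x\cap y$; $[x][x]y=[\sim x][x]y=[x]y$. A $\mathbb{K}$-probability distribution on a Bayesian algebra $E$ is a $\mathbb{K}$-probability distribution $P$ on the Boolean algebra $E$ such that $P(x\cap y)=P([x]y)P(x)$ for all $x,y\in E$. A Bayesian algebra $B_{ayes}$ is a Bayesian extension of the Boolean algebra $B_{oole}$ if there is an injective Boolean morphism $\delta:B_{oole}\to B_{ayes}$ such that for every ordered field $\mathbb{K}$ and every $\mathbb{K}$-probability distribution $P_{oole}$ on $B_{oole}$ there is a $\mathbb{K}$-probability distribution $P_{ayes}$ on the Bayesian algebra $B_{ayes}$ with $P_{ayes}\circ\delta=P_{oo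le}$.
   Formalization: ''Boolean automorphism'' is read as Boolean endomorphism (bijectivity with [x]x = ⊤ would force at most two elements, so no infinite Bayesian algebra), and the Boolean algebra is assumed to have ⊥ ≠ ⊤ (for the one-element algebra the extension has one element). *)

(* Defs.v *)
From mathcomp Require Import all_boot all_order all_algebra.
From mathcomp Require Import boolp classical_sets functions cardinality.

Set Implicit Arguments.
Unset Strict Implicit.
Unset Printing Implicit Defensive.

Import Order.TTheory GRing.Theory Num.Theory.

(* A Boolean algebra is a [ctbDistrLatticeType], with [Order.le] as inclusion.
   That structure allows [\bot = \top]: nondegeneracy has to be stated apart. *)

Record boolean_morphism d d' (A : ctbDistrLatticeType d)
    (B : ctbDistrLatticeType d') (f : A -> B) : Prop := BooleanMorphism {
  bmorphI : forall x y, f (x `&` y)%O = (f x `&` f y)%O;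
  bmorphU : forall x y, f (x `|` y)%O = (f x `|` f y)%O;
  bmorphC : forall x, f (~` x)%O = (~` f x)%O;
  bmorph0 : f \bot%O = \bot%O;
  bmorph1 : f \top%O = \top%O
}.

(* [cond x y] is [x]y. Each [cond x] is a Boolean endomorphism and is not
   required to be bijective: [cond x x = \top = cond x \top] whenever
   [x != \bot], so bijectivity would leave only the elements [\bot], [\top]. *)
Record bayesian_algebra d (E : ctbDistrLatticeType d) (cond : E -> E -> E)
    : Prop := BayesianAlgebra {
  cond_morph : forall x, boolean_morphism (cond x);
  cond_sub : forall x y, (x <= y)%O -> cond x y = \top%O \/ x = \bot%O;
  cond_meet : forall x y, (x `&` cond x y)%O = (x `&` y)%O;
  cond_idem : forall x y, cond x (cond x y) = cond x y;
  cond_compl : forall x y, cond (~` x)%O (cond x y) = cond x y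
}.

Record probability_distribution d (E : ctbDistrLatticeType d)
    (K : realFieldType) (P : E -> K) : Prop := ProbabilityDistribution {
  prob_ge0 : forall x, (0 <= P x)%R;
  prob0 : P \bot%O = 0%R;
  prob1 : P \top%O = 1%R;
  probIU : forall x y, (P (x `&` y)%O + P (x `|` y)%O = P x + P y)%R
}.

Record bayesian_distribution d (E : ctbDistrLatticeType d)
    (cond : E -> E -> E) (K : realFieldType) (P : E -> K)
    : Prop := BayesianDistribution {
  bayesian_prob : probability_distribution P;
  bayesian_cond : forall x y, P (x `&` y)%O = (P (cond x y) * P x)%R
}.

Definition bayesian_extension d d' (B : ctbDistrLatticeType d)
    (E : ctbDistrLatticeType d') (cond : E -> E -> E) : Prop :=
  bayesian_algebra cond /\
  exists delta : B -> E,
    [/\ boolean_morphism delta, injective delta &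
      forall (K : realFieldType) (P : B -> K), probability_distribution P ->
        exists Q : E -> K,
          bayesian_distribution cond Q /\ forall x, Q (delta x) = P x].

(* |X| = max {|Y|, |Z|} *)
Definition card_eq_max (X Y Z : Type) : Prop :=
  [/\ ([set: Y] #<= [set: X])%card, ([set: Z] #<= [set: X])%card &
    ([set: X] #= [set: Y])%card \/ ([set: X] #= [set: Z])%card].

(* Main.v *)
(** The idea: represent everything by sets. On a set algebra over [X], choose
for each event [x] other than [set0] and [setT] a retraction [r_x : X -> x] such
that [r_x \o r_{~x} = r_x], and put [[x]y := r_x @^-1` y]; the axioms of a Bayesian
algebra follow. A distribution [Q] is Bayesian as soon as
[Q (x `&` y) = Q (r_x @^-1` y) * Q x].

Such retractions are produced level by level. To a point of [X] one adjoins, for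
each event [x] and each [i : nat], a point [s (x, i)] of [x]; the new coordinates
are independent, those indexed by [(x, i)] following the law [Q(. | x)]. Given
that the root lies in [x], the sequence
[.., s (x, 1), s (x, 0), root, s (~x, 0), s (~x, 1), ..] is independent, with law
[Q(. | x)] up to the root and [Q(. | ~x)] after it; shifting it by one carries
[x] onto [~x] and multiplies [Q] by [Q (~x) / Q x], since this is the change of the
law of the root. Hence [r_x] is the identity on [x] and that shift on [~x].

Starting from the Stone space of the given algebra and iterating [nat] times, every
event of the limit gets its retraction from the level after the one where it appears,
and the coordinates of later levels, which are left unchanged by it, are independent
of that level. All products involved are finitely additive, so they exist
over any ordered field. *)
From HB Require Import structures.
Require Import Defs.
From mathcomp Require Import all_boot all_order all_algebra.
From mathcomp Require Import boolp classical_sets functions cardinality.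
From mathcomp Require Import ring lra.

Set Implicit Arguments.
Unset Strict Implicit.
Unset Printing Implicit Defensive.

Import Order.Theory GRing.Theory Num.Theory.
Local Open Scope classical_set_scope.
Local Open Scope ring_scope.

(** * Generated set algebras *)

Record set_algebra Y (A : set (set Y)) : Prop := SetAlgebra {
  alg0 : A set0;
  algI : forall a b, A a -> A b -> A (a `&` b);
  algC : forall a, A a -> A (~` a)
}.

Section SetAlgebra.
Variables (Y : Type) (A : set (set Y)).
Hypothesis algA : set_algebra A.

Lemma algT : A setT.
Proof. by rewrite -setC0; apply: algC (alg0 _). Qed.

Lemma algD a b : A a -> A b -> A (a `\` b).
Proof. by move=> Aa Ab; rewrite setDE; apply: algI => //; apply: algC. Qed.

Lemma algU a b : A a -> A b -> A (a `|` b).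
Proof.
move=> Aa Ab; rewrite -[_ `|` _]setCK setCU.
by apply: algC => //; apply: algI => //; apply: algC.
Qed.

End SetAlgebra.

Definition agree Y (C : seq (set Y)) (y y' : Y) : Prop :=
  forall g, g \in C -> (g y <-> g y').

(** Relativised to [S] so that inductions on [C] can cut [S] in two along the first set of the
    list. *)
Definition decides_on Y (S : set Y) (C : seq (set Y)) (e : set Y) : Prop :=
  forall y y', S y -> S y' -> agree C y y' -> e y -> e y'.

Definition decides Y := @decides_on Y setT.

(** The algebra generated by [G]: a set is a finite Boolean combination of generators exactly when
    finitely many of them determine membership in it. *)
Definition generated Y (G : set (set Y)) : set (set Y) :=
  [set e | exists2 C : seq (set Y), {in C, forall g, G g} & decides C e].

Section Generated.
Variable Y : Type.
Implicit Types (S e g : set Y) (C : seq (set Y)) (A G : set (set Y)).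

Lemma sub_decides C C' e : {subset C <= C'} -> decides C e -> decides C' e.
Proof. by move=> CC' Ce y y' _ _ ag; apply: Ce => // g /CC'; apply: ag. Qed.

Lemma decides_on_nil S e : decides_on S [::] e ->
  S `&` e = S \/ S `&` e = set0.
Proof.
move=> Se; have [[y [Sy ey]]|Se0] := pselect ((S `&` e) !=set0); [left|right].
  by apply/seteqP; split => [z []//|z Sz]; split => //; apply: Se ey.
exact/nonemptyPn.
Qed.

Lemma decides_on_cons S g C e : decides_on S (g :: C) e ->
  decides_on (S `&` g) C e /\ decides_on (S `\` g) C e.
Proof.
move=> Se; split=> y y' [Sy gy] [Sy' gy'] ag; apply: Se => // h.
  by rewrite in_cons => /orP[/eqP->|]; [split|apply: ag].
by rewrite in_cons => /orP[/eqP->|]; [split|apply: ag].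
Qed.

(** Cutting [S] along the members of [C] one by one ends in pieces that lie inside [e] or miss
    it. *)
Lemma alg_decides_on A S C e : set_algebra A -> A S ->
  {in C, forall g, A g} -> decides_on S C e -> A (S `&` e).
Proof.
move=> algA; elim: C S => [|g C IH] S AS AC.
  by case/decides_on_nil => ->//; apply: alg0.
case/decides_on_cons => Sg Sng.
have Ag : A g by apply: AC; rewrite mem_head.
have AC' : {in C, forall g, A g}.
  by move=> h hC; apply: AC; rewrite inE hC orbT.
have -> : S `&` e = (S `&` g `&` e) `|` ((S `\` g) `&` e).
  by rewrite -setIUl setUIDK.
by apply: (algU algA); apply: IH => //; [apply: algI|apply: algD].
Qed.

Lemma alg_decides A C e : set_algebra A ->
  {in C, forall g, A g} -> decides C e -> A e.
Proof.
by move=> algA AC Ce; rewrite -[e]setTI; apply: alg_decides_on Ce; rewrite //;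
  apply: algT.
Qed.

Lemma generated_alg G : set_algebra (generated G).
Proof.
split.
- by exists [::] => // y y' _ _ _ [].
- move=> a b [C CG Ca] [D DG Db]; exists (C ++ D).
    by move=> g; rewrite mem_cat => /orP[/CG|/DG].
  move=> y y' _ _ ag [ay b_y]; split.
    by apply: (Ca y) => // g gC; apply: ag; rewrite mem_cat gC.
  by apply: (Db y) => // g gC; apply: ag; rewrite mem_cat gC orbT.
- move=> a [C CG Ca]; exists C => // y y' _ _ ag nay ay'; apply: nay.
  by apply: (Ca y' y) => // g gC; split=> /(ag g gC).
Qed.

Lemma sub_generated G g : G g -> generated G g.
Proof.
move=> Gg; exists [:: g]; first by move=> h; rewrite inE => /eqP->.
by move=> y y' _ _ ag; apply: (ag g _).1; rewrite mem_head.
Qed.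

End Generated.

Lemma generated_preimage Y Z (G : set (set Y)) (A : set (set Z)) (h : Z -> Y) e :
  set_algebra A -> (forall g, G g -> A (h @^-1` g)) ->
  generated G e -> A (h @^-1` e).
Proof.
move=> algA GA [C CG Ce].
apply: (@alg_decides _ A [seq h @^-1` g | g <- C]) => //.
  by move=> _ /mapP[g /CG/GA Ag ->].
move=> z z' _ _ ag; apply: Ce => // g gC.
by apply: (ag (h @^-1` g)); apply: map_f.
Qed.

(** * Finitely additive charges *)

Definition pick_in Y (y0 : Y) (S : set Y) : Y :=
  if pselect (S !=set0) is left S0 then projT1 (cid S0) else y0.

Lemma pickP Y (y0 : Y) (S : set Y) : S !=set0 -> S (pick_in y0 S).
Proof. by rewrite /pick_in; case: pselect => // S0 _; case: cid. Qed.

Definition additive_on (K : realFieldType) Y (A : set (set Y)) (Q : set Y -> K) :=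
  forall a b, A a -> A b -> Q a = Q (a `&` b) + Q (a `\` b).

Record charge (K : realFieldType) Y (A : set (set Y)) (Q : set Y -> K) : Prop :=
  Charge {
  charge_ge0 : forall a, A a -> 0 <= Q a;
  chargeT : Q setT = 1;
  charge_add : additive_on A Q
}.

Section Charge.
Variables (K : realFieldType) (Y : Type).
Implicit Types (S e g : set Y) (C : seq (set Y)) (A G R : set (set Y)).

Lemma additive_on0 A (Q : set Y -> K) : A set0 -> additive_on A Q -> Q set0 = 0.
Proof. by move=> A0 /(_ _ _ A0 A0); rewrite setI0 setD0; lra. Qed.

Lemma additive_onU A (Q : set Y -> K) a b : set_algebra A -> additive_on A Q ->
  A a -> A b -> Q (a `&` b) + Q (a `|` b) = Q a + Q b.
Proof.
move=> algA Qadd Aa Ab; rewrite (Qadd _ _ (algU algA Aa Ab) Aa).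
have -> : (a `|` b) `&` a = a by apply/setIidr => y; left.
by rewrite setDUl setDv set0U (Qadd b a) // setIC; ring.
Qed.

(** Cutting along generators stays within [R] and ends in pieces whose intersection with [e] is in
    [R] or empty, where both functions agree. *)
Lemma additive_eq A G R (Q Q' : set Y -> K) : set_algebra A ->
  additive_on A Q -> additive_on A Q' ->
  G `<=` A -> R `<=` A -> R setT ->
  (forall g, G g -> G (~` g)) -> (forall S g, R S -> G g -> R (S `&` g)) ->
  (forall S, R S -> Q S = Q' S) -> forall e, generated G e -> Q e = Q' e.
Proof.
move=> algA Qadd Qadd' GA RA RT GC RG RQ e [C CG Ce].
have Ae : A e by apply: (alg_decides algA _ Ce) => g /CG/GA.
suff H S : R S -> decides_on S C e -> Q (S `&` e) = Q' (S `&` e).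
  by rewrite -[e]setTI H.
elim: C S CG {Ce} => [|g C IH] S CG RS.
  case/decides_on_nil => ->; first exact: RQ.
  by rewrite (additive_on0 (alg0 algA) Qadd) (additive_on0 (alg0 algA) Qadd').
case/decides_on_cons => Sg Sng; have Gg : G g by apply: CG; rewrite mem_head.
have CG' : {in C, forall g, G g}.
  by move=> h hC; apply: CG; rewrite in_cons hC orbT.
have ASe : A (S `&` e) by apply: algI => //; apply: RA.
rewrite (Qadd _ _ ASe (GA _ Gg)) (Qadd' _ _ ASe (GA _ Gg)).
have -> : S `&` e `&` g = S `&` g `&` e by rewrite setIAC.
have -> : S `&` e `\` g = (S `\` g) `&` e by rewrite !setDE setIAC.
by rewrite !IH //; [rewrite setDE; apply: RG => //; apply: GC|apply: RG].
Qed.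

(** * Extending a function from rectangles to a charge *)

Variables (y0 : Y) (G R : set (set Y)) (q : set Y -> K).
Hypotheses (GC : forall g, G g -> G (~` g)) (GR : G `<=` R) (RT : R setT).
Hypothesis RI : forall S T, R S -> R T -> R (S `&` T).
Hypotheses (q_ge0 : forall S, R S -> 0 <= q S) (qT : q setT = 1).
Hypothesis q0 : q set0 = 0.
Hypothesis q_split : forall S g, R S -> G g -> q S = q (S `&` g) + q (S `&` ~` g).

(* Mass given to [e] by the discrete measure putting the mass of each atom of
   the partition of [S] by [C] on a single element of that atom. *)
Fixpoint discrete_mass S C e : K :=
  if C is g :: C' then
    discrete_mass (S `&` g) C' e + discrete_mass (S `&` ~` g) C' e
  else q S * `[< e (pick_in y0 S) >]%:R.

Let RG S g : R S -> G g -> R (S `&` g).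
Proof. by move=> RS /GR; apply: RI. Qed.

Let RGC S g : R S -> G g -> R (S `&` ~` g).
Proof. by move=> RS /GC; apply: RG. Qed.

Let inG C := {in C, forall g, G g}.

Let inG_cons g C : inG (g :: C) -> G g /\ inG C.
Proof.
move=> CG; split=> [|h hC]; apply: CG; first by rewrite mem_head.
by rewrite in_cons hC orbT.
Qed.

Lemma discrete_mass_ge0 S C e : R S -> inG C -> 0 <= discrete_mass S C e.
Proof.
elim: C S => [|g C IH] S RS /=; first by rewrite mulr_ge0 ?q_ge0.
by case/inG_cons => Gg CG; rewrite addr_ge0 ?IH //; [apply: RG|apply: RGC].
Qed.

Lemma discrete_massT S C : R S -> inG C -> discrete_mass S C setT = q S.
Proof.
elim: C S => [|g C IH] S RS /=; first by rewrite asboolT ?mulr1.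
case/inG_cons => Gg CG; rewrite !IH ?(q_split RS Gg)//.
  exact: RGC. exact: RG.
Qed.

Lemma discrete_mass_add S C a b : discrete_mass S C a =
  discrete_mass S C (a `&` b) + discrete_mass S C (a `\` b).
Proof.
elim: C S => [|g C IH] S /=; last by rewrite !IH [LHS]addrACA.
rewrite -mulrDr; congr (_ * _).
set p := pick_in y0 S.
have -> : `[< (a `&` b) p >] = `[< a p >] && `[< b p >] by exact: asbool_and.
have -> : `[< (a `\` b) p >] = `[< a p >] && ~~ `[< b p >].
  by rewrite -asbool_neg -asbool_and.
by case: `[< a p >]; case: `[< b p >]; rewrite ?addr0 ?add0r.
Qed.

Let q_empty S : ~ (S !=set0) -> q S = 0.
Proof. by move/nonemptyPn->. Qed.

Let discrete_mass_nil S e : R S -> decides_on S [::] e ->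
  discrete_mass S [::] e = q (S `&` e).
Proof.
move=> RS Se /=; have [S0|S0] := pselect (S !=set0); last first.
  by rewrite q_empty // mul0r q_empty // => -[y [Sy _]]; apply: S0; exists y.
have Sp := pickP y0 S0.
case/decides_on_nil: Se => SeE; rewrite SeE.
  by rewrite asboolT ?mulr1 //; move: Sp; rewrite -{1}SeE => -[].
by rewrite asboolF ?mulr0 ?q0 // => ep; have : set0 (pick_in y0 S) by rewrite -SeE.
Qed.

(** On a piece cut out by [C], [e] is all or nothing, so its mass there is [q] of the piece or 0; by
    [q_split] a further cut along [g] does not change this. *)
Lemma discrete_mass_cons S C e g : R S -> G g -> inG C -> decides_on S C e ->
  discrete_mass S (g :: C) e = discrete_mass S C e.
Proof.
move=> RS Gg; elim: C S RS => [|c C IH] S RS.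
  move=> _ Se; have Sg : decides_on (S `&` g) [::] e.
    by move=> y y' [Sy _] [Sy' _]; apply: Se.
  have Sng : decides_on (S `&` ~` g) [::] e.
    by move=> y y' [Sy _] [Sy' _]; apply: Se.
  rewrite /= -[LHS]/(discrete_mass (S `&` g) [::] e +
                     discrete_mass (S `&` ~` g) [::] e).
  rewrite -[RHS]/(discrete_mass S [::] e).
  rewrite !discrete_mass_nil //; [|exact: RGC|exact: RG].
  case/decides_on_nil: Se => SeE; rewrite SeE; rewrite [S `&` g `&` e]setIAC.
    by rewrite [S `&` ~` g `&` e]setIAC SeE -q_split.
  by rewrite [S `&` ~` g `&` e]setIAC SeE !set0I q0 addr0.
case/inG_cons => Gc CG /decides_on_cons[Sc Snc] /=.
rewrite -[RHS]/(discrete_mass (S `&` c) C e + discrete_mass (S `&` ~` c) C e).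
rewrite -(IH (S `&` c)) //; last exact: RG.
rewrite -(IH (S `&` ~` c)) //=; last exact: RGC.
by rewrite addrACA ![_ `&` c `&` _]setIAC ![_ `&` ~` c `&` _]setIAC.
Qed.

Lemma discrete_mass_cat S C D e : R S -> inG C -> inG D -> decides_on S C e ->
  discrete_mass S (D ++ C) e = discrete_mass S C e.
Proof.
move=> RS CG; elim: D S RS => // g D IH S RS /inG_cons[Gg DG] Se.
rewrite -(discrete_mass_cons RS Gg CG Se) /=.
rewrite !IH //; [exact: RGC| |exact: RG|];
by move=> y y' [Sy _] [Sy' _]; apply: Se.
Qed.

Lemma discrete_mass_catr S C D e : R S -> inG C -> inG D -> decides_on S C e ->
  discrete_mass S (C ++ D) e = discrete_mass S C e.
Proof.
move=> RS CG DG; elim: C S RS CG => [|g C IH] S RS.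
  by move=> _ Se; rewrite -(@discrete_mass_cat S [::] D) ?cats0.
case/inG_cons=> Gg CG /decides_on_cons[Sg Sng] /=.
by rewrite !IH //; [exact: RGC|exact: RG].
Qed.

Lemma discrete_mass_rect S C T : R S -> R T -> inG C -> decides_on S C T ->
  discrete_mass S C T = q (S `&` T).
Proof.
move=> RS RT'; elim: C S RS => [|g C IH] S RS; first by move=> _ /discrete_mass_nil->.
case/inG_cons=> Gg CG /decides_on_cons[Sg Sng] /=.
rewrite !IH //; [|exact: RGC|exact: RG].
by rewrite [_ `&` g `&` _]setIAC [_ `&` ~` g `&` _]setIAC -q_split//; apply: RI.
Qed.

(** The value at [e] is the discrete mass along any list deciding [e]: two lists agree because both
    agree with their concatenation. A concatenation also decides two events at once, whence
    additivity. *)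
Lemma charge_extension : exists Q : set Y -> K,
  charge (generated G) Q /\ forall S, R S -> generated G S -> Q S = q S.
Proof.
pose Q e := if pselect (generated G e) is left H
  then discrete_mass setT (s2val (cid2 H)) e else 0.
have QE C e : inG C -> decides C e -> Q e = discrete_mass setT C e.
  move=> CG Ce; rewrite /Q; case: pselect => [H|[]]; last by exists C.
  case: (cid2 H) => D /= DG De.
  by rewrite -(@discrete_mass_catr setT D C) // discrete_mass_cat.
exists Q; split; first split.
- by move=> e [C CG Ce]; rewrite (QE C) //; apply: discrete_mass_ge0.
- by rewrite (QE [::]) ?discrete_massT.
- move=> a b [C CG Ca] [D DG Db].
  have CDG : inG (C ++ D).
    by move=> g; rewrite mem_cat => /orP[/CG|/DG].
  have CDa : decides (C ++ D) a.
    by apply: sub_decides Ca => g gC; rewrite mem_cat gC.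
  have CDb : decides (C ++ D) b.
    by apply: sub_decides Db => g gC; rewrite mem_cat gC orbT.
  rewrite !(QE (C ++ D)) // -?discrete_mass_add //.
    move=> y y' _ _ ag [ay nby]; split; first exact: (CDa y).
    by move=> /(CDb y' y) nby'; apply/nby/nby' => // g gC; split=> /(ag g gC).
  by move=> y y' _ _ ag [ay b_y]; split; [apply: (CDa y)|apply: (CDb y)].
- move=> S RS [C CG CS].
  by rewrite (QE C) // discrete_mass_rect // setTI.
Qed.

End Charge.

(** * Adjoining independent coordinates *)

Record level := Level {
  carrier : Type;
  base : carrier;
  events : set (set carrier)
}.
Arguments events : clear implicits.

Section NextLevel.
Variable L : level.
Let X := carrier L.

(** [None] is the root. All subsets of [X] serve as indices, so that points and shifts carry no
    proofs about events; [valid] later singles out the indices that are events. *)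
Definition coord := option (set X * nat).

(** Falling back on [setT] for the empty set keeps every domain nonempty, so that points exist. *)
Definition dom (j : coord) : set X :=
  if j is Some k then (if pselect (k.1 !=set0) then k.1 else setT) else setT.

Lemma dom_pick j : dom j (pick_in (base L) (dom j)).
Proof.
apply: pickP; case: j => [[x i]|] /=; last by exists (base L).
by case: pselect => [//|nx0]; exists (base L).
Qed.

Definition stream := {s : set X * nat -> X | forall k, dom (Some k) (s k)}.

Definition next_point := (X * stream)%type.

Definition co (p : next_point) (j : coord) : X := if j is Some k then sval p.2 k else p.1.

Lemma co_dom p j : dom j (co p j).
Proof. by case: j => [k|] //; apply: (svalP p.2). Qed.

Lemma point_ext p p' : (forall j, co p j = co p' j) -> p = p'.
Proof.
move: p p' => [w [s Ps]] [w' [s' Ps']] pp'; congr (_, _); first exact: (pp' None).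
by apply: eq_exist; apply/funext => k; apply: (pp' (Some k)).
Qed.

Definition mk_coord (f : coord -> X) (j : coord) : X :=
  if pselect (dom j (f j)) then f j else pick_in (base L) (dom j).

Lemma mk_coord_dom f j : dom j (mk_coord f j).
Proof. by rewrite /mk_coord; case: pselect => //= nd; apply: dom_pick. Qed.

Definition mk_stream (f : coord -> X) : stream :=
  exist (fun s : set X * nat -> X => forall k, dom (Some k) (s k))
    (fun k => mk_coord f (Some k)) (fun k => mk_coord_dom f (Some k)).

(* Coordinates of [f] lying outside their domain are replaced. *)
Definition mk_point (f : coord -> X) : next_point :=
  (f None, mk_stream f).

Lemma co_mk_point f j : (forall j, dom j (f j)) -> co (mk_point f) j = f j.
Proof.
by move=> fP; case: j => [k|] //=; rewrite /mk_coord; case: pselect.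
Qed.

(** * Cylinders and the next level *)

Definition cyl (j : coord) (a : set X) : set next_point := [set p | a (co p j)].

Definition valid : set coord := [set j | if j is Some k then events L k.1 else True].

Definition cylinders : set (set next_point) :=
  [set g | exists j a, [/\ valid j, events L a & g = cyl j a]].

Definition next : level :=
  Level (mk_point (fun=> base L)) (generated cylinders).

Lemma next_alg : set_algebra (events next).
Proof. exact: generated_alg. Qed.

Lemma cyl_next j a : valid j -> events L a -> events next (cyl j a).
Proof. by move=> vj La; apply: sub_generated; exists j, a. Qed.

Lemma root_next a : events L a -> events next [set p | a p.1].
Proof. by move=> La; apply: (@cyl_next None). Qed.

(* For each [y] the coordinates [.., (y, 1), (y, 0), None, (~` y, 0),
   (~` y, 1), ..] form a bi-infinite sequence, which is shifted by one. *)
Definition shift_coord (y : set X) (j : coord) : coord :=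
  if j is Some (z, i) then
    if z == y then (if i is i'.+1 then Some (y, i') else None)
    else if z == ~` y then Some (z, i.+1) else j
  else Some (~` y, 0%N).

Definition shift (y : set X) (p : next_point) : next_point :=
  mk_point (fun j => co p (shift_coord y j)).

Lemma neq_setC (y : set X) : (y == ~` y) = false.
Proof.
apply/negP => /eqP yE; have [yb|nyb] := pselect (y (base L)).
  by have := yb; rewrite {1}yE.
by have := nyb; rewrite {1}yE => /contrapT.
Qed.

(** The sequence of the complement of [y] is that of [y] read backwards, so the two shifts are
    mutually inverse. *)
Lemma shift_coordK y : cancel (shift_coord (~` y)) (shift_coord y).
Proof.
case=> [[z i]|] /=; last by rewrite setCK eqxx.
case: (eqVneq z (~` y)) => [->|zny].
  by case: i => [|i] //=; rewrite eq_sym neq_setC eqxx.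
rewrite setCK; case: (eqVneq z y) => [->|zy] /=; first by rewrite eqxx.
by rewrite (negbTE zy) (negbTE zny).
Qed.

Lemma shift_coordCK y : cancel (shift_coord y) (shift_coord (~` y)).
Proof. by move=> j; have := @shift_coordK (~` y) j; rewrite setCK. Qed.

(** The only index whose new value could leave its domain is [(y, 0)], which receives the old root;
    as this lies in [y], [mk_point] replaces nothing. *)
Lemma co_shift y p j : y p.1 -> (~` y) !=set0 ->
  co (shift y p) j = co p (shift_coord y j).
Proof.
move=> yp ny; apply: co_mk_point => {}j.
case: j => [[z i]|] //.
have [->|zy] := eqVneq z y.
  rewrite /= eqxx; case: pselect => // y0; case: i => [|i] //.
  by have := co_dom p (Some (y, i)); rewrite /=; case: pselect.
rewrite /shift_coord (negbTE zy); case: ifP => [/eqP->|_]; last exact: co_dom.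
exact: (co_dom p (Some (~` y, i.+1))).
Qed.

Lemma root_shift y p : y p.1 -> (~` y) !=set0 -> (~` y) (shift y p).1.
Proof.
move=> yp ny; rewrite -[(shift y p).1]/(co (shift y p) None) co_shift //=.
by have := co_dom p (Some (~` y, 0%N)); rewrite /=; case: pselect.
Qed.

Lemma shiftK y p : y p.1 -> (~` y) !=set0 -> shift (~` y) (shift y p) = p.
Proof.
move=> yp ny; apply: point_ext => j.
have y0 : (~` ~` y) !=set0 by rewrite setCK; exists p.1.
by rewrite !co_shift ?shift_coordCK ?shift_coordK //; apply: root_shift.
Qed.

(** * Retractions onto events *)

Definition retract (a : set X) (p : next_point) : next_point :=
  if pselect (a p.1) then p else shift (~` a) p.

Lemma retract_id a p : a p.1 -> retract a p = p.
Proof. by rewrite /retract; case: pselect. Qed.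

Lemma retract_out a p : ~ a p.1 -> retract a p = shift (~` a) p.
Proof. by rewrite /retract; case: pselect. Qed.

Lemma retract_in a p : a !=set0 -> a (retract a p).1.
Proof.
move=> a0; have [ap|nap] := pselect (a p.1); first by rewrite retract_id.
by rewrite retract_out //; have := @root_shift (~` a) p nap; rewrite setCK; apply.
Qed.

(** Off [a] the inner retraction is the identity; on [a] it shifts and the outer one shifts back. *)
Lemma retractC a p : a !=set0 -> (~` a) !=set0 ->
  retract a (retract (~` a) p) = retract a p.
Proof.
move=> a0 na0; have [ap|nap] := pselect (a p.1); last first.
  by rewrite (@retract_id (~` a)).
rewrite (@retract_out (~` a)); last by move/(_ ap).
rewrite setCK retract_out; last exact: root_shift.
by rewrite shiftK // retract_id.
Qed.

Hypothesis algL : set_algebra (events L).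

Lemma valid_shift a j : events L a -> valid j -> valid (shift_coord a j).
Proof.
move=> La; case: j => [[z i]|] /=; last by move=> _; apply: algC.
by move=> Lz; case: eqP => // _; [case: i|case: ifP].
Qed.

Lemma retract_next a e : events L a -> (~` a) !=set0 -> a !=set0 ->
  events next e -> events next (retract a @^-1` e).
Proof.
move=> La na0 a0; apply: generated_preimage; first exact: next_alg.
move=> _ [j [c [vj Lc ->]]].
(* Depending on the root, the retraction fixes the point or renames its coordinates, so a cylinder
   pulls back to two cylinders glued along the root. *)
have -> : retract a @^-1` cyl j c = ((cyl None a) `&` cyl j c) `|`
    (cyl (shift_coord (~` a) j) c `\` cyl None a).
  apply/seteqP; split=> p.
    have [ap|nap] := pselect (a p.1); first by rewrite /= retract_id //; left.
    by rewrite /cyl/= retract_out // co_shift ?setCK //; right.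
  case=> [[/= ap cp]|[/= cp nap]]; first by rewrite /cyl/= retract_id.
  by rewrite /cyl/= retract_out // co_shift ?setCK.
have nL := algC algL La.
apply: (algU next_alg); first by apply: (algI next_alg); apply: cyl_next.
by apply: (algD next_alg); apply: cyl_next => //; apply: valid_shift.
Qed.

End NextLevel.

(** * The product charge *)

Section ProductCharge.
Variables (K : realFieldType) (L : level).
Hypothesis algL : set_algebra (events L).
Let X := carrier L.
Variable Q : set X -> K.
Hypothesis chQ : charge (events L) Q.

Let Q0 : Q set0 = 0.
Proof. by apply: additive_on0 (charge_add chQ); apply: alg0. Qed.

(* Given a null event, any charge concentrated on it will do. *)
Definition cond_law (x b : set X) : K :=
  if `[< events L x /\ Q x != 0 >] then Q (b `&` x) / Q x
  else `[< b (pick_in (base L) (dom (Some (x, 0%N)))) >]%:R.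

Definition law (j : coord L) : set X -> K :=
  if j is Some k then cond_law k.1 else Q.

Lemma dirac_charge (A : set (set X)) (y : X) :
  charge A (fun b => `[< b y >]%:R : K).
Proof.
split=> [b _||a b _ _]; first exact: ler0n.
  by rewrite asboolT.
have -> : `[< (a `&` b) y >] = `[< a y >] && `[< b y >] by exact: asbool_and.
have -> : `[< (a `\` b) y >] = `[< a y >] && ~~ `[< b y >].
  by rewrite -asbool_neg -asbool_and.
by case: `[< a y >]; case: `[< b y >]; rewrite ?addr0 ?add0r.
Qed.

Lemma cond_law_charge x : charge (events L) (cond_law x).
Proof.
rewrite /cond_law; case: asboolP => [[Lx Qx]|_]; last exact: dirac_charge.
split=> [b Lb||a b La Lb].
- by rewrite divr_ge0 ?(charge_ge0 chQ) //; apply: algI.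
- by rewrite setTI divff.
- rewrite -mulrDl; congr (_ / _).
  rewrite (charge_add chQ (algI algL La Lx) Lb) setIAC; congr (_ + Q _).
  by rewrite !setDE setIAC.
Qed.

Lemma law_charge j : charge (events L) (law j).
Proof. by case: j => [k|] //=; apply: cond_law_charge. Qed.

(** For a null [x] both sides vanish by positivity, whatever the default law is. *)
Lemma cond_lawM x b : events L x -> events L b ->
  Q (b `&` x) = Q x * cond_law x b.
Proof.
move=> Lx Lb; rewrite /cond_law; case: asboolP => [[_ Qx]|].
  by rewrite mulrC divfK.
move=> nx; have Qx : Q x = 0.
  by apply/eqP; apply: contra_notT nx => ?.
have := charge_add chQ Lx Lb; rewrite Qx mul0r setIC.
have := charge_ge0 chQ (algI algL Lb Lx).
have := charge_ge0 chQ (algD algL Lx Lb); lra.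
Qed.

(** Each law is concentrated on its domain, including the default one, whose point is picked
    there. *)
Lemma law_dom j b : events L b -> b `&` dom j = set0 -> law j b = 0.
Proof.
move=> Lb; case: j => [[x i]|] /=; last by rewrite setIT => ->.
rewrite /cond_law; case: asboolP => [[Lx Qx]|_].
  case: pselect => [x0 ->|nx0]; first by rewrite Q0 mul0r.
  by case/negP: Qx; move/nonemptyPn: nx0 => ->; rewrite Q0.
move=> b0; rewrite asboolF // => bp.
move: b0; rewrite -subset0; apply; split; first exact: bp.
exact: (dom_pick (Some (x, 0%N))).
Qed.

Lemma law_eq j a b : events L a -> events L b ->
  a `&` dom j = b `&` dom j -> law j a = law j b.
Proof.
move=> La Lb ab; rewrite (charge_add (law_charge j) La Lb).
rewrite (charge_add (law_charge j) Lb La) [b `&` a]setIC.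
have ba := esym ab; have D c d : c `&` dom j = d `&` dom j -> (c `\` d) `&` dom j = set0.
  move=> cd; apply/seteqP; split => // y [[cy ndy] Dy].
  have : (d `&` dom j) y by rewrite -cd.
  by case.
by rewrite (@law_dom j (a `\` b)) ?(@law_dom j (b `\` a)) ?D //; apply: (algD algL).
Qed.

Definition rect (a : coord L -> set X) : set (next_point L) :=
  [set p | forall j, a j (co p j)].

Record rect_on (a : coord L -> set X) (s : seq (coord L)) : Prop := RectOn {
  rect_uniq : uniq s;
  rect_events : forall j, events L (a j);
  rect_supp : forall j, j \notin s -> a j = setT
}.

Let mass a s := \prod_(j <- s) law j (a j).

Lemma rect_mass_sub a s u : rect_on a s -> uniq u -> {subset s <= u} ->
  mass a s = mass a u.
Proof.
move=> [us _ as_] uu su.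
rewrite /mass [RHS](bigID (mem s)) /= [X in _ * X]big1 ?mulr1; last first.
  by move=> j /as_->; apply: chargeT (law_charge j).
rewrite -[RHS]big_filter; apply: perm_big; apply: uniq_perm => //.
  exact: filter_uniq.
by move=> j; rewrite mem_filter andb_idr // => /su.
Qed.

Lemma rect_on_sub a s u : rect_on a s -> uniq u -> {subset s <= u} -> rect_on a u.
Proof.
move=> [us La as_] uu su; split=> // j ju; apply: as_.
by apply: contra ju; apply: su.
Qed.

(** If every side met its domain, choosing a point in each would give an element of the rectangle.
    So some side misses its domain and contributes a factor 0. *)
Lemma rect_mass0 a s : rect_on a s -> rect a = set0 -> mass a s = 0.
Proof.
move=> [us La as_] a0.
have [[j ja]|aD] := pselect (exists j, a j `&` dom j = set0).
  have [js|js] := boolP (j \in s).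
    by rewrite /mass (big_rem j js) /= law_dom ?mul0r.
  by have := dom_pick j; rewrite -[dom j]setTI -(as_ _ js) ja.
exfalso.
have P j : exists y, (a j `&` dom j) y.
  by apply: contrapT => ne; apply: aD; exists j; apply/nonemptyPn.
have [f fP] := choice P.
have : rect a (mk_point f).
  by move=> j; rewrite co_mk_point => [|i]; [case: (fP j)|case: (fP i)].
by rewrite a0.
Qed.

(** Changing only the coordinate [j] of [p] shows that a nonempty rectangle determines the trace of
    each side on its domain. *)
Lemma rect_proj a b p j : rect a p -> rect a = rect b ->
  a j `&` dom j `<=` b j `&` dom j.
Proof.
move=> ap ab y [ay Dy]; split => //.
pose f i := if i == j then y else co p i.
have fD i : dom i (f i).
  by rewrite /f; case: eqP => [->|_] //; apply: co_dom.
have : rect a (mk_point f).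
  by move=> i; rewrite co_mk_point // /f; case: eqP => [->|_] //; apply: ap.
by rewrite ab => /(_ j); rewrite co_mk_point // /f eqxx.
Qed.

(** Makes [rect_charge] independent of the chosen presentation. Nonempty rectangles are compared
    side by side over the union of the two supports. *)
Lemma rect_mass_eq a b s t : rect_on a s -> rect_on b t -> rect a = rect b ->
  mass a s = mass b t.
Proof.
move=> ha hb ab; have [[p ap]|/nonemptyPn a0] := pselect (rect a !=set0); last first.
  by rewrite !rect_mass0 // -ab.
pose u := undup (s ++ t); have uu : uniq u by apply: undup_uniq.
rewrite (rect_mass_sub ha uu) => [|j js]; last by rewrite mem_undup mem_cat js.
rewrite (rect_mass_sub hb uu) => [|j jt]; last by rewrite mem_undup mem_cat jt orbT.
apply: eq_bigr => j _; apply: law_eq; [exact: rect_events ha _|exact: rect_events hb _|].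
by apply/seteqP; split; [apply: (rect_proj ap)|apply: (@rect_proj _ _ p)];
  rewrite -?ab.
Qed.

Definition rect_set : set (set (next_point L)) :=
  [set S | exists a s, rect_on a s /\ S = rect a].

Definition rect_charge (S : set (next_point L)) : K :=
  if pselect (rect_set S) is left H
  then mass (projT1 (cid H)) (projT1 (cid (projT2 (cid H)))) else 0.

Lemma rect_chargeE a s : rect_on a s -> rect_charge (rect a) = mass a s.
Proof.
move=> ha; rewrite /rect_charge; case: pselect => [H|[]]; last by exists a, s.
have [hb ab] := projT2 (cid (projT2 (cid H))).
exact: rect_mass_eq hb ha (esym ab).
Qed.

Definition restr (a : coord L -> set X) j (c : set X) i :=
  if i == j then a i `&` c else a i.

Lemma rect_restr a j c : rect (restr a j c) = rect a `&` cyl j c.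
Proof.
apply/seteqP; split=> p.
  move=> ap; split; last by have := ap j; rewrite /restr eqxx => -[].
  by move=> i; have := ap i; rewrite /restr; case: eqP => // _ [].
by case=> ap cp i; rewrite /restr; case: eqP => [->|_] //; split.
Qed.

Lemma rect_on_restr a s j c : rect_on a s -> j \in s -> events L c ->
  rect_on (restr a j c) s.
Proof.
move=> [us La as_] js Lc; split => // [i|i is_]; rewrite /restr.
  by case: eqP => // _; apply: algI.
by case: eqP => [ij|_]; [rewrite ij js in is_|apply: as_].
Qed.

Lemma rect_on_ext a s j : rect_on a s -> rect_on a (undup (j :: s)).
Proof.
move=> ha; apply: rect_on_sub ha _ _; first exact: undup_uniq.
by move=> i is_; rewrite mem_undup in_cons is_ orbT.
Qed.

Lemma rectT : rect (fun=> setT) = setT.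
Proof. by apply/seteqP; split. Qed.

Lemma rect_onT s : uniq s -> rect_on (fun=> setT) s.
Proof. by move=> us; split => // j; apply: algT. Qed.

Lemma mass_restr a s j c : rect_on a s -> j \in s -> events L c ->
  mass a s = mass (restr a j c) s + mass (restr a j (~` c)) s.
Proof.
move=> [us La _] js Lc; rewrite /mass !(bigD1_seq j) //=.
have E d : \prod_(i <- s | i != j) law i (restr a j d i) =
           \prod_(i <- s | i != j) law i (a i).
  by apply: eq_bigr => i /negbTE ij; rewrite /restr ij.
rewrite !E -mulrDl; congr (_ * _); rewrite /restr eqxx -setDE.
exact: (charge_add (law_charge j) (La j) Lc).
Qed.

Theorem product_charge : exists Q' : set (next_point L) -> K,
  charge (events (next L)) Q' /\
  forall a s, rect_on a s -> Q' (rect a) = mass a s.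
Proof.
(* Every coordinate is allowed here, valid or not, as in [rect_on]; the events of the next level lie
   in this larger algebra. *)
pose G := [set g : set (next_point L) | exists j a, events L a /\ g = cyl j a].
have subG : @cylinders L `<=` G by move=> _ [j [a [_ La ->]]]; exists j, a.
have subgG : events (next L) `<=` generated G.
  by move=> e [C CG Ce]; exists C => // g /CG/subG.
have [Q' [chQ' Q'E]] : exists Q' : set (next_point L) -> K,
    charge (generated G) Q' /\
    forall S, rect_set S -> generated G S -> Q' S = rect_charge S.
  apply: (@charge_extension _ _ (mk_point (fun=> base L))).
  - move=> _ [j [a [La ->]]]; exists j, (~` a); split => //; exact: algC.
  - move=> _ [j [a [La ->]]]; exists (restr (fun=> setT) j a), [:: j].
    rewrite rect_restr rectT setTI; split => //.
    by apply: rect_on_restr; rewrite ?mem_head //; apply: rect_onT.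
  - by exists (fun=> setT), [::]; split; rewrite ?rectT //; apply: rect_onT.
  - move=> _ _ [a [s [ha ->]]] [b [t [hb ->]]].
    exists (fun j => a j `&` b j), (undup (s ++ t)); split.
      split; first exact: undup_uniq.
        move=> j; apply: (algI algL); [exact: rect_events ha _|].
        exact: rect_events hb _.
      move=> j; rewrite mem_undup mem_cat negb_or => /andP[js jt].
      by rewrite (rect_supp ha) // (rect_supp hb) // setIT.
    apply/seteqP; split=> p; first by case=> ap bp j; split.
    by move=> ap; split=> j; case: (ap j).
  - move=> _ [a [s [ha ->]]]; rewrite (rect_chargeE ha).
    by apply: prodr_ge0 => j _; apply: (charge_ge0 (law_charge j));
      apply: (rect_events ha).
  - by rewrite -rectT (rect_chargeE (rect_onT (s := [::]) _)) // /mass big_nil.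
  - have [[a [s [ha S0]]]|nS] := pselect (rect_set set0).
      by rewrite S0 (rect_chargeE ha) rect_mass0.
    by rewrite /rect_charge; case: pselect.
  - move=> _ _ [a [s [ha ->]]] [j [c [Lc ->]]].
    have hj := rect_on_ext j ha; set u := undup (j :: s) in hj.
    have ju : j \in u by rewrite mem_undup mem_head.
    have -> : ~` cyl j c = cyl j (~` c) by [].
    rewrite -!rect_restr !(@rect_chargeE _ u) //; first exact: mass_restr.
      by apply: rect_on_restr => //; apply: algC.
    exact: rect_on_restr.
exists Q'; split.
  case: chQ' => ge0 T add; split=> // [a /subgG|a b /subgG Ga /subgG Gb];
    [exact: ge0|exact: add].
move=> a s ha; rewrite Q'E; first exact: rect_chargeE.
  by exists a, s.
have [us La as_] := ha.
exists [seq cyl j (a j) | j <- s].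
  by move=> _ /mapP[j _ ->]; exists j, (a j).
move=> p p' _ _ ag ap j; have [js|js] := boolP (j \in s); last by rewrite as_.
by apply/(ag (cyl j (a j))); [apply: map_f|apply: ap].
Qed.

End ProductCharge.

(** * Retractions and charges *)

Section StepCharge.
Variables (K : realFieldType) (L : level).
Hypothesis algL : set_algebra (events L).
Let X := carrier L.

Lemma rect_next (a : coord L -> set X) s : rect_on a s ->
  {in s, forall j, valid j} -> events (next L) (rect a).
Proof.
move=> [_ La as_] vs; exists [seq cyl j (a j) | j <- s].
  by move=> _ /mapP[j /vs vj ->]; exists j, (a j).
move=> p p' _ _ ag ap j; have [js|js] := boolP (j \in s); last by rewrite as_.
by apply/(ag (cyl j (a j))); [apply: map_f|apply: ap].
Qed.

(** Rectangles generate, so it suffices to compare on them; a support containing [t] makes the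
    factors at these coordinates appear in the products. *)
Lemma next_additive_eq (t : seq (coord L)) (Q1 Q2 : set (next_point L) -> K) :
  {in t, forall j, valid j} ->
  additive_on (events (next L)) Q1 -> additive_on (events (next L)) Q2 ->
  (forall a s, rect_on a s -> {in s, forall j, valid j} -> {subset t <= s} ->
    Q1 (rect a) = Q2 (rect a)) ->
  forall e, events (next L) e -> Q1 e = Q2 e.
Proof.
move=> vt add1 add2 eqR.
pose R := [set S : set (next_point L) | exists a s, [/\ rect_on a s,
  {in s, forall j, valid j}, {subset t <= s} & S = rect a]].
apply: (@additive_eq _ _ _ _ R _ _ (next_alg L) add1 add2).
- exact: sub_generated.
- by move=> _ [a [s [ha vs _ ->]]]; apply: rect_next vs.
- exists (fun=> setT), (undup t); split.
  + exact/rect_onT/undup_uniq.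
  + by move=> j; rewrite mem_undup; apply: vt.
  + by move=> j; rewrite mem_undup.
  + by rewrite rectT.
- by move=> _ [j [a [vj La ->]]]; exists j, (~` a); split=> //; apply: algC.
- move=> _ _ [a [s [ha vs ts ->]]] [j [c [vj Lc ->]]].
  exists (restr a j c), (undup (j :: s)); split.
  + apply: (rect_on_restr algL) => //; first exact: rect_on_ext.
    by rewrite mem_undup mem_head.
  + by move=> i; rewrite mem_undup in_cons => /orP[/eqP->|/vs].
  + by move=> i it; rewrite mem_undup in_cons ts ?orbT.
  + by rewrite rect_restr.
- by move=> _ [a [s [ha vs ts ->]]]; apply: eqR ha vs ts.
Qed.

Lemma lift_next (h : carrier L -> carrier L) :
  (forall c, events L c -> events L (h @^-1` c)) ->
  forall e, events (next L) e ->
    events (next L) ((fun p : next_point L => (h p.1, p.2) : next_point L) @^-1` e).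
Proof.
move=> hL e; apply: generated_preimage => [|_ [[k|] [c [vj Lc ->]]]].
- exact: next_alg.
- by rewrite -[_ @^-1` _]/(cyl (Some k) c); apply: cyl_next.
- rewrite -[_ @^-1` _]/(cyl None (h @^-1` c)).
  by apply: cyl_next => //; apply: hL.
Qed.

Variables (Q : set X -> K) (Q' : set (next_point L) -> K).
Hypothesis chQ : charge (events L) Q.
Hypothesis chQ' : charge (events (next L)) Q'.
Hypothesis Q'E : forall a s, rect_on a s ->
  Q' (rect a) = \prod_(j <- s) law Q j (a j).

Lemma charge_root a : events L a -> Q' [set p | a p.1] = Q a.
Proof.
move=> La; pose b := restr (fun=> setT) (None : coord L) a.
have hb : rect_on b [:: None].
  by apply: (rect_on_restr algL); rewrite ?mem_head //; apply: rect_onT.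
have -> : [set p | a p.1] = rect b by rewrite rect_restr rectT setTI.
by rewrite (Q'E hb) big_seq1 /= /b /restr eqxx setTI.
Qed.

(* Law of the coordinates given that the root lies in [y]. *)
Let law_given (y : set X) (j : coord L) : set X -> K :=
  if j is Some k then law Q j else cond_law Q y.

(** Conditioning on the root touches only the factor at [None], which [cond_lawM] splits into [Q y]
    and the conditional law. *)
Lemma charge_root_rect y a s : events L y -> rect_on a s -> None \in s ->
  Q' (cyl None y `&` rect a) = Q y * \prod_(j <- s) law_given y j (a j).
Proof.
move=> Ly ha Ns; rewrite setIC -rect_restr.
rewrite (Q'E (rect_on_restr algL ha Ns Ly)) !(bigD1_seq None) //=;
  try exact: rect_uniq ha.
rewrite mulrA {1}/restr eqxx (cond_lawM algL chQ) //; last exact: rect_events ha _.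
congr (_ * _); apply: eq_bigr => -[k|] // _.
Qed.

(** Along the sequence the law passes from that of [x] to that of its complement just after the root
    if the root lies in [x], just before it otherwise; the shift makes up for this one place. *)
Lemma law_given_shift x j : law_given (~` x) (shift_coord (~` x) j) = law_given x j.
Proof.
case: j => [[z i]|] /=; last by rewrite setCK.
case: eqP => [->|_]; first by case: i.
by rewrite setCK; case: eqP => [->|].
Qed.

Lemma retract_rect (x : set X) (a : coord L -> set X) : (~` x) !=set0 -> x !=set0 ->
  retract x @^-1` rect a =
  (cyl None x `&` rect a) `|` (cyl None (~` x) `&` rect (a \o shift_coord x)).
Proof.
move=> nx0 x0; apply/seteqP; split=> p /=.
  have [xp|nxp] := pselect (x p.1); first by rewrite retract_id //; left.
  rewrite retract_out // => ap; right; split => // j.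
  have := ap (shift_coord x j).
  by rewrite co_shift ?setCK // shift_coordCK.
case=> [[/= xp ap]|[/= nxp ap]]; first by rewrite retract_id.
rewrite retract_out // => j.
by rewrite co_shift ?setCK //; have := ap (shift_coord (~` x) j);
  rewrite /= shift_coordK.
Qed.

Lemma preimage_additive (Y Z : Type) (A : set (set Y)) (B : set (set Z))
    (P : set Y -> K) (h : Y -> Z) : additive_on A P ->
  (forall b, B b -> A (h @^-1` b)) -> additive_on B (fun b => P (h @^-1` b)).
Proof. by move=> add hB a b Ba Bb; apply: add; apply: hB. Qed.

Lemma setI_additive (Y : Type) (A : set (set Y)) (P : set Y -> K) x :
  set_algebra A -> A x -> additive_on A P -> additive_on A (fun a => P (x `&` a)).
Proof.
move=> algA Ax add a b Aa Ab /=; rewrite (add _ _ (algI algA Ax Aa) Ab) setIA.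
by congr (_ + P _); rewrite !setDE setIA.
Qed.

Lemma mulr_additive (Y : Type) (A : set (set Y)) (P : set Y -> K) k :
  additive_on A P -> additive_on A (fun a => P a * k).
Proof. by move=> add a b Aa Ab; rewrite -mulrDl; congr (_ * _); apply: add. Qed.

(** On a rectangle, let [M] be the product of the laws given that the root is in [x]. Over [x] the
    preimage has mass [Q x * M]; over the complement it is a shifted rectangle of mass
    [(1 - Q x) * M]. It thus has mass [M], while the left side is [Q x * M]. *)
Lemma charge_retract x e : events L x -> x !=set0 -> (~` x) !=set0 ->
  events (next L) e ->
  Q' (cyl None x `&` e) = Q' (retract x @^-1` e) * Q x.
Proof.
move=> Lx x0 nx0; move: e.
have Lnx := algC algL Lx; have algN := next_alg L.
have cx : events (next L) (cyl None x) by apply: cyl_next.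
have cnx : events (next L) (cyl None (~` x)) by apply: cyl_next.
have addQ' := charge_add chQ'.
(* The second coordinate is the one that the shift sends to [None], so that [None] lies in the
   shifted support [u] too. *)
apply: (@next_additive_eq [:: None; Some (~` x, 0%N)]
  (fun e => Q' (cyl None x `&` e)) (fun e => Q' (retract x @^-1` e) * Q x)).
- by move=> j; rewrite !inE => /orP[/eqP->|/eqP->].
- exact: setI_additive.
- apply: mulr_additive; apply: preimage_additive addQ' _ => e.
  exact: retract_next.
move=> a s ha vs ts.
have Ns : None \in s by apply: ts; rewrite inE.
have xs : Some (~` x, 0%N) \in s by apply: ts; rewrite !inE eqxx orbT.
pose u := map (shift_coord (~` x)) s.
have ub : rect_on (a \o shift_coord x) u.
  split=> [|j|j ju].
  - by rewrite map_inj_uniq ?(rect_uniq ha) //; apply: can_inj (@shift_coordK _ x).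
  - exact: rect_events ha _.
  - apply: (rect_supp ha); apply: contra ju => js.
    by rewrite -[j](shift_coordCK x); apply: map_f.
have Nu : None \in u.
  by apply/mapP; exists (Some (~` x, 0%N)) => //=; rewrite ?eqxx.
have prodE : \prod_(j <- u) law_given (~` x) j ((a \o shift_coord x) j) =
             \prod_(j <- s) law_given x j (a j).
  rewrite big_map; apply: eq_bigr => j _.
  by rewrite law_given_shift /= shift_coordK.
have vu : {in u, forall j, valid j}.
  by move=> _ /mapP[j /vs vj ->]; apply: valid_shift.
have Er : events (next L) (rect a) by apply: rect_next ha vs.
have Er' : events (next L) (rect (a \o shift_coord x)) by apply: rect_next vu.
rewrite retract_rect // (charge_root_rect Lx ha Ns) mulrC; congr (_ * _).
have := additive_onU algN addQ' (algI algN cx Er) (algI algN cnx Er').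
have -> : cyl None x `&` rect a `&`
    (cyl None (~` x) `&` rect (a \o shift_coord x)) = set0.
  by apply/seteqP; split=> // p [[xp _] [nxp _]]; apply: nxp.
rewrite (additive_on0 (alg0 algN) addQ') add0r => ->.
rewrite (charge_root_rect Lx ha Ns) (charge_root_rect Lnx ub Nu) prodE.
rewrite -mulrDl; have := charge_add chQ (algT algL) Lx.
by rewrite setTI setTD (chargeT chQ) => <-; rewrite mul1r.
Qed.

(** Only the root factor of a rectangle changes under [h]; the others are common to both sides. This
    carries the identity for a retraction to all later levels. *)
Lemma charge_lift (h : X -> X) x : events L x ->
  (forall c, events L c -> events L (h @^-1` c)) ->
  (forall c, events L c -> Q (x `&` c) = Q (h @^-1` c) * Q x) ->
  forall e, events (next L) e ->
    Q' (cyl None x `&` e) =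
    Q' ((fun p : next_point L => (h p.1, p.2) : next_point L) @^-1` e) * Q x.
Proof.
move=> Lx hL hQ; have algN := next_alg L; have addQ' := charge_add chQ'.
have cx : events (next L) (cyl None x) by apply: cyl_next.
have h'L := lift_next hL; set h' := fun p : next_point L => _ in h'L *.
apply: (@next_additive_eq [:: None]
  (fun e => Q' (cyl None x `&` e)) (fun e => Q' (h' @^-1` e) * Q x)).
- by move=> j; rewrite !inE => /eqP->.
- exact: setI_additive.
- by apply: mulr_additive; apply: preimage_additive addQ' h'L.
move=> a s ha vs ts; have Ns : None \in s by apply: ts; rewrite inE.
pose b (j : coord L) := if j is Some _ then a j else h @^-1` a None.
have hb : rect_on b s.
  split=> [|[k|]|[k|]]; [exact: rect_uniq ha|exact: rect_events ha _| | |].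
  - by apply: hL; apply: rect_events ha _.
  - exact: (rect_supp ha).
  - by rewrite Ns.
have -> : h' @^-1` rect a = rect b.
  apply/seteqP; split=> p ap j; first by have := ap j; case: j.
  by have := ap j; case: j.
rewrite setIC -rect_restr (Q'E (rect_on_restr algL ha Ns Lx)) (Q'E hb).
rewrite !(bigD1_seq None) //=; try exact: rect_uniq ha.
rewrite {1}/restr eqxx setIC hQ; last exact: rect_events ha _.
by rewrite mulrAC; congr (_ * _ * _); apply: eq_bigr => -[k|].
Qed.

End StepCharge.

(** * The limit of the levels *)

Section Tower.
Variable L0 : level.
Hypothesis algL0 : set_algebra (events L0).

Fixpoint lvl n : level := if n is m.+1 then next (lvl m) else L0.

Lemma lvl_alg n : set_algebra (events (lvl n)).
Proof. by case: n => //= n; apply: next_alg. Qed.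

(** A point of level [n] is a nested pair of a point of [L0] and [n] streams. Flattened into a
    sequence of streams, a point of the limit has prefixes, which [pr] reads and [put]
    overwrites. *)
Definition limit := (carrier L0 * forall n, stream (lvl n))%type.
Implicit Types (f : limit) (x y S : set limit).

Fixpoint pr n f : carrier (lvl n) :=
  if n is m.+1 return carrier (lvl n) then (pr m f, f.2 m) else f.1.

Fixpoint put n : carrier (lvl n) -> limit -> limit :=
  if n is m.+1 return carrier (lvl n) -> limit -> limit
  then fun p f => ((put p.1 f).1, dfwith (put p.1 f).2 p.2)
  else fun w f => (w, f.2).

Lemma pr_ext n f f' : f.1 = f'.1 -> (forall m, (m < n)%N -> f.2 m = f'.2 m) ->
  pr n f = pr n f'.
Proof.
move=> ff'1; elim: n => //= n IH ff'; congr (_, _); last exact: ff'.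
by apply: IH => m mn; apply: ff'; apply: ltnW.
Qed.

Lemma put_stream n p f m : (n <= m)%N -> (@put n p f).2 m = f.2 m.
Proof.
elim: n p => //= n IH p nm; rewrite dfwith_out; first exact/IH/ltnW.
by rewrite neq_ltn nm.
Qed.

Lemma pr_put n p f : pr n (put p f) = p.
Proof.
elim: n p => //= n IH p; rewrite dfwith_in [RHS]surjective_pairing; congr (_, _).
rewrite -[RHS](IH p.1); apply: pr_ext => //= m mn.
by rewrite dfwith_out // neq_ltn mn orbT.
Qed.

Lemma limit_ext n f f' : pr n f = pr n f' ->
  (forall m, (n <= m)%N -> f.2 m = f'.2 m) -> f = f'.
Proof.
elim: n => [|n IH] /= ff' sff'.
  case: f f' ff' sff' => [w s] [w' s'] /= -> ss'; congr (_, _).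
  by apply: functional_extensionality_dep => m; apply: ss'.
case: ff' => ff' fn; apply: IH => // m; rewrite leq_eqVlt => /orP[/eqP<-//|].
exact: sff'.
Qed.

Lemma put_pr n f : put (pr n f) f = f.
Proof. by apply: (@limit_ext n) => [|m nm]; rewrite ?pr_put ?put_stream. Qed.

Lemma put_put n (p p' : carrier (lvl n)) f : put p (put p' f) = put p f.
Proof. by apply: (@limit_ext n) => [|m nm]; rewrite ?pr_put ?put_stream. Qed.

(** * Events of the limit *)

Definition event_at n : set (set limit) :=
  [set S | exists2 a, events (lvl n) a & S = pr n @^-1` a].

Definition limit_events : set (set limit) := [set S | exists n, event_at n S].

Lemma event_at_le n m : (n <= m)%N -> event_at n `<=` event_at m.
Proof.
elim: m => [|m IH]; first by rewrite leqn0 => /eqP->.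
rewrite leq_eqVlt ltnS => /orP[/eqP->//|/IH nm] S /nm[a La ->].
by exists [set p | a p.1] => //; apply: root_next.
Qed.

Lemma event_at_alg n : set_algebra (event_at n).
Proof.
have algn := lvl_alg n; split.
- by exists set0; [apply: alg0|].
- by move=> _ _ [a La ->] [b Lb ->]; exists (a `&` b) => //; apply: algI.
- by move=> _ [a La ->]; exists (~` a) => //; apply: algC.
Qed.

Lemma limit_alg : set_algebra limit_events.
Proof.
split.
- by exists 0%N; apply: alg0 (event_at_alg 0).
- move=> a b [n na] [m mb]; exists (maxn n m); apply: (algI (event_at_alg _)).
    exact: event_at_le (leq_maxl _ _) _ na.
  exact: event_at_le (leq_maxr _ _) _ mb.
- by move=> a [n na]; exists n; apply: (algC (event_at_alg _)).
Qed.

Definition rank x : nat := pick_in 0%N [set n | event_at n x].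

Lemma rankP x : limit_events x -> event_at (rank x) x.
Proof. exact: pickP. Qed.

(** Both sets appear at the same levels, so the same level is picked. Their retractions are then
    built at one level, where [retractC] relates them. *)
Lemma rankC x : rank (~` x) = rank x.
Proof.
rewrite /rank; congr pick_in; apply/seteqP; split=> n /= nx.
  by rewrite -[x]setCK; apply: algC nx; apply: event_at_alg.
by apply: algC nx; apply: event_at_alg.
Qed.

(** * Retractions of the limit *)

Definition limit_retract x f : limit :=
  if pselect (x !=set0 /\ (~` x) !=set0) then
    put (retract (pr (rank x) @` x) (pr (rank x).+1 f) : carrier (lvl (rank x).+1)) f
  else f.

Lemma pr_image n (a : set (carrier (lvl n))) f :
  pr n @` (pr n @^-1` a) = a.
Proof.
apply/seteqP; split=> [_ [g ag <-]//|p ap].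
by exists (put p f); rewrite /= pr_put.
Qed.

(* The retraction onto the event of rank [n] given by [a], read at the later
   level [k + n.+1]. *)
Fixpoint retract_at n (a : set (carrier (lvl n))) k :
    carrier (lvl (k + n.+1)) -> carrier (lvl (k + n.+1)) :=
  if k is k'.+1 return carrier (lvl (k + n.+1)) -> carrier (lvl (k + n.+1))
  then fun p => (retract_at a p.1, p.2) else retract a.

(** [put] leaves the later streams alone, so a later level sees the retraction act on its part of
    level [n.+1] only. *)
Lemma pr_retract n a k f :
  pr (k + n.+1) (put (retract a (pr n.+1 f) : carrier (lvl n.+1)) f) =
  @retract_at n a k (pr (k + n.+1) f).
Proof.
elim: k => [|k IH]; first exact: pr_put.
rewrite -[LHS]/(pr (k + n.+1) _, _) IH put_stream //.
exact: leq_addl.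
Qed.

Lemma retract_at_events n a k e : events (lvl n) a -> a !=set0 -> (~` a) !=set0 ->
  events (lvl (k + n.+1)) e ->
  events (lvl (k + n.+1)) (@retract_at n a k @^-1` e).
Proof.
move=> La a0 na0; elim: k e => [|k IH] e.
  exact: (retract_next (lvl_alg n)).
exact: (lift_next IH).
Qed.

Lemma limit_retractE x : limit_events x -> x !=set0 -> (~` x) !=set0 ->
  exists n a, [/\ events (lvl n) a, x = pr n @^-1` a, a !=set0,
    (~` a) !=set0 &
    forall f,
      limit_retract x f = put (retract a (pr n.+1 f) : carrier (lvl n.+1)) f /\
      limit_retract (~` x) f =
        put (retract (~` a) (pr n.+1 f) : carrier (lvl n.+1)) f].
Proof.
move=> Lx [g xg] [g' nxg']; have [a La xE] := rankP Lx; exists (rank x), a.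
split=> //; [by exists (pr (rank x) g); move: xg; rewrite {1}xE| |].
  by exists (pr (rank x) g'); move: nxg'; rewrite {1}xE.
move=> f; have aE : pr (rank x) @` x = a by rewrite -[RHS](pr_image a g) -xE.
have naE : pr (rank x) @` (~` x) = ~` a.
  by rewrite -[RHS](pr_image (~` a) g) -preimage_setC -xE.
rewrite /limit_retract rankC aE naE; split; case: pselect => // -[].
  by split; [exists g|exists g'].
by rewrite setCK; split; [exists g'|exists g].
Qed.

Lemma limit_retract_id x f : limit_events x -> x f -> limit_retract x f = f.
Proof.
move=> Lx xf; have [nx|nx] := pselect ((~` x) !=set0); last first.
  by rewrite /limit_retract; case: pselect => //= -[? ?]; case: nx.
have x0 : x !=set0 by exists f.
have [n [a [La xE a0 na0 E]]] := limit_retractE Lx x0 nx.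
by rewrite (E f).1 retract_id ?put_pr //; move: xf; rewrite xE.
Qed.

Lemma limit_retract_in x f : limit_events x -> x !=set0 -> x (limit_retract x f).
Proof.
move=> Lx x0; have [xf|nxf] := pselect (x f); first by rewrite limit_retract_id.
have nx0 : (~` x) !=set0 by exists f.
have [n [a [La xE a0 na0 E]]] := limit_retractE Lx x0 nx0.
rewrite (E f).1 xE -[(_ @^-1` _) _]/(a (pr n.+1 _).1) pr_put.
exact: retract_in.
Qed.

Lemma limit_retractC x f : limit_events x ->
  limit_retract x (limit_retract (~` x) f) = limit_retract x f.
Proof.
move=> Lx; have [x0|x0] := pselect (x !=set0 /\ (~` x) !=set0); last first.
  congr limit_retract; rewrite /limit_retract; case: pselect => //.
  by rewrite setCK => -[? ?]; case: x0.
case: x0 => x0 nx0.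
have [n [a [La xE a0 na0 E]]] := limit_retractE Lx x0 nx0.
by rewrite (E f).1 (E f).2 (E _).1 pr_put put_put retractC.
Qed.

Lemma limit_retract_events x y : limit_events x -> limit_events y ->
  limit_events (limit_retract x @^-1` y).
Proof.
move=> Lx Ly; have [[x0 nx0]|x0] := pselect (x !=set0 /\ (~` x) !=set0); last first.
  rewrite (_ : limit_retract x = id) //.
  by apply/funext => f; rewrite /limit_retract; case: pselect.
have [n [a [La xE a0 na0 E]]] := limit_retractE Lx x0 nx0.
(* View [y] at a level of the form [m + n.+1], where [retract_at] describes the retraction. *)
case: Ly => m /(event_at_le (leq_addr n.+1 m))[c Lc ->].
exists (m + n.+1)%N, (@retract_at n a m @^-1` c); first exact: retract_at_events.
by apply/seteqP; split=> f /=; rewrite (E f).1 pr_retract.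
Qed.

(** * Charges on the limit *)

Section LimitCharge.
Variables (K : realFieldType) (Q0 : set (carrier L0) -> K).
Hypothesis chQ0 : charge (events L0) Q0.

Fixpoint tower_charge n : {Q : set (carrier (lvl n)) -> K | charge (events (lvl n)) Q} :=
  if n is m.+1
  return {Q : set (carrier (lvl n)) -> K | charge (events (lvl n)) Q}
  then let H := cid (product_charge (lvl_alg m) (svalP (tower_charge m))) in
       exist _ (projT1 H) (projT2 H).1
  else exist _ Q0 chQ0.

Let Qs n := sval (tower_charge n).
Arguments Qs : clear implicits.

Let chQs n : charge (events (lvl n)) (Qs n).
Proof. exact: svalP (tower_charge n). Qed.

Let QsE n a s : rect_on a s -> Qs n.+1 (rect a) = \prod_(j <- s) law (Qs n) j (a j).
Proof.
by rewrite /Qs /=; case: cid => /= Q' [_ Q'E]; apply: Q'E.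
Qed.

Let Qs_root n a : events (lvl n) a -> Qs n.+1 [set p | a p.1] = Qs n a.
Proof. by apply: (charge_root (lvl_alg n)); [apply: QsE]. Qed.

Let Qs_le n m a : (n <= m)%N -> events (lvl n) a ->
  exists b, [/\ events (lvl m) b, pr n @^-1` a = pr m @^-1` b & Qs n a = Qs m b].
Proof.
elim: m a => [|m IH] a.
  by rewrite leqn0 => /eqP n0; move: a; rewrite n0 => a La; exists a.
rewrite leq_eqVlt ltnS => /orP[/eqP n0|nm].
  by move: a; rewrite n0 => a La; exists a.
case/(IH _ nm) => b [Lb -> ->]; exists [set p | b p.1].
by split; [apply: root_next|by []|rewrite Qs_root].
Qed.

Definition limit_charge S : K :=
  if pselect (limit_events S) then Qs (rank S) (pr (rank S) @` S) else 0.

Lemma limit_chargeE n a : events (lvl n) a -> limit_charge (pr n @^-1` a) = Qs n a.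
Proof.
move=> La; have LS : limit_events (pr n @^-1` a) by exists n, a.
rewrite /limit_charge; case: pselect => //= _.
have [b Lb SE] := rankP LS; set r := rank _ in b Lb SE *.
have f : limit := put (base (lvl n)) (base L0, fun m => (base (lvl m.+1)).2).
rewrite SE (pr_image _ f).
have [a' [La' aE ->]] := Qs_le (leq_maxl n r) La.
have [b' [Lb' bE ->]] := Qs_le (leq_maxr n r) Lb.
by congr (Qs _ _); rewrite -(pr_image a' f) -(pr_image b' f) -aE -bE SE.
Qed.

Lemma limit_charge_charge : charge limit_events limit_charge.
Proof.
split.
- by move=> _ [n [a La ->]]; rewrite limit_chargeE //; apply: (charge_ge0 (chQs n)).
- rewrite -[setT]/(pr 0 @^-1` setT) limit_chargeE; last exact: algT.
  exact: chargeT (chQs 0).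
- move=> _ _ [n [a La ->]] [m [b Lb ->]].
  have [a' [La' -> _]] := Qs_le (leq_maxl n m) La.
  have [b' [Lb' -> _]] := Qs_le (leq_maxr n m) Lb.
  set r := maxn n m in a' La' b' Lb' *.
  rewrite -[_ `&` _]/(pr r @^-1` (a' `&` b')) -[_ `\` _]/(pr r @^-1` (a' `\` b')).
  have algr := lvl_alg r.
  rewrite !limit_chargeE //; [|exact: algD|exact: algI].
  exact: (charge_add (chQs r)).
Qed.

Lemma limit_charge_cond x y : limit_events x -> limit_events y ->
  limit_charge (x `&` y) = limit_charge (limit_retract x @^-1` y) * limit_charge x.
Proof.
move=> Lx Ly; have [[x0 nx0]|x0] := pselect (x !=set0 /\ (~` x) !=set0); last first.
  (* Here [x] is [set0] or [setT]: both sides are 0 in the first case and the mass of [y] in the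
     second. *)
  rewrite (_ : limit_retract x = id); last first.
    by apply/funext => f; rewrite /limit_retract; case: pselect.
  have [xe|/nonemptyPn xe] := pselect (x !=set0); last first.
    rewrite xe set0I (additive_on0 (alg0 limit_alg) (charge_add limit_charge_charge)).
    by rewrite mulr0.
  have /nonemptyPn nxe : ~ ((~` x) !=set0) by move=> ?; apply: x0.
  have -> : x = setT by rewrite -[x]setCK nxe setC0.
  by rewrite setTI (chargeT limit_charge_charge) mulr1.
have [n [a [La xE a0 na0 E]]] := limit_retractE Lx x0 nx0.
case: Ly => m /(event_at_le (leq_addr n.+1 m))[c Lc ->].
have -> : limit_retract x @^-1` (pr (m + n.+1) @^-1` c) =
          pr (m + n.+1) @^-1` (@retract_at n a m @^-1` c).
  by apply/seteqP; split=> f /=; rewrite (E f).1 pr_retract.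
suff [b [Lb xb bc]] : exists b, [/\ events (lvl (m + n.+1)) b,
    x = pr (m + n.+1) @^-1` b & forall c, events (lvl (m + n.+1)) c ->
      Qs (m + n.+1) (b `&` c) =
      Qs (m + n.+1) (@retract_at n a m @^-1` c) * Qs (m + n.+1) b].
  rewrite xb -[_ `&` _]/(pr (m + n.+1) @^-1` (b `&` c)).
  rewrite !limit_chargeE ?bc //; first exact: retract_at_events.
  exact: (algI (lvl_alg _)).
(* [charge_retract] gives the identity at level [n.+1]; each later level inherits it by
   [charge_lift]. *)
elim: m {c Lc} => [|k [b [Lb xb bc]]].
  exists (cyl None a); split; [exact: root_next|exact: xE|].
  move=> c Lc; rewrite [X in _ * X]Qs_root //.
  exact: (charge_retract (lvl_alg n) (chQs n) (chQs n.+1) (@QsE n)).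
exists (cyl None b); split; [exact: root_next|exact: xb|].
move=> c Lc; rewrite [X in _ * X]Qs_root //.
apply: (charge_lift (lvl_alg _) (chQs (k + n.+1).+1) (@QsE (k + n.+1))) => //.
by move=> e; apply: retract_at_events.
Qed.

End LimitCharge.

End Tower.

(** * Stone representation *)

Section Stone.
Variables (d : Order.disp_t) (B : ctbDistrLatticeType d).

(** The equivalences say that membership in [u] is a Boolean morphism to truth values. *)
Record ultrafilter (u : set B) : Prop := Ultrafilter {
  ultraI : forall x y, u (x `&` y)%O <-> u x /\ u y;
  ultraC : forall x, u (~` x)%O <-> ~ u x
}.

Lemma ultra0 u : ultrafilter u -> ~ u \bot%O.
Proof.
move=> [uI uC] u0; have := u0; rewrite -(meetxC (\bot%O : B)) uI uC.
by case.
Qed.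

Lemma ultraT u : ultrafilter u -> u \top%O.
Proof.
by move=> uu; rewrite -compl0 (ultraC uu); apply: ultra0.
Qed.

Lemma ultraU u : ultrafilter u -> forall x y, u (x `|` y)%O <-> u x \/ u y.
Proof.
move=> [uI uC] x y; rewrite -[(x `|` y)%O]complK complU.
rewrite uC uI !uC; split=> [|[ux|uy] []//]; move/not_andP.
by case=> /contrapT; [left|right].
Qed.

Lemma ultra_exists (b : B) : b <> \bot%O -> exists2 u, ultrafilter u & u b.
Proof.
move=> b0.
(* The last clause admits the empty set, the union of the empty chain, and makes every other filter
   contain [b]. *)
pose filter (F : set B) := [/\ forall x y, F x -> F y -> F (x `&` y)%O,
  forall x y, F x -> (x <= y)%O -> F y, ~ F \bot%O & forall x, F x -> F b].
have [|F [[FI Fle F0 Fb] Fmax]] := @Zorn_bigcup _ filter.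
  move=> C CF Ctot; split.
  - move=> x y [F CFF Fx] [G CG Gy].
    have [FG|GF] := Ctot _ _ CFF CG.
      by exists G => //; have [GI _ _ _] := CF _ CG; apply: GI => //; apply: FG.
    by exists F => //; have [FI _ _ _] := CF _ CFF; apply: FI => //; apply: GF.
  - move=> x y [F CFF Fx] xy; exists F => //.
    by have [_ Fle _ _] := CF _ CFF; apply: Fle xy.
  - by case=> F CFF F0; have [_ _ /(_ F0)] := CF _ CFF.
  - by move=> x [F CFF Fx]; exists F => //; have [_ _ _] := CF _ CFF; apply; exact: Fx.
have {}Fmax G : filter G -> F `<=` G -> G `<=` F.
  by move=> fG FG; apply: contrapT => nGF; apply: (Fmax G) => //; split.
have Fb1 : F b.
  apply: contrapT => nFb; apply: (nFb).
  apply: (Fmax [set x | (b <= x)%O]); rewrite /= ?lexx //.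
    split=> [x y bx b_y|x y bx xy|/=|x _ /=]; rewrite /= ?lexx //.
    - by rewrite lexI bx.
    - exact: le_trans xy.
    - by rewrite lex0 => /eqP.
  by move=> x /Fb.
exists F => //; have FC x : F (~` x)%O <-> ~ F x.
  split=> [Fnx Fx|nFx].
    by apply: F0; rewrite -(meetxC x); apply: FI.
  (* [F] enlarged by the complement of [x] stays proper: a member of [F] disjoint from that
     complement lies below [x] and would put [x] in [F]. *)
  apply: (Fmax [set z | exists2 f, F f & (f `&` ~` x <= z)%O]).
  - split.
    + move=> y z [f Ff fy] [g Fg gz]; exists (f `&` g)%O; first exact: FI.
      rewrite lexI (le_trans _ fy) ?(le_trans _ gz) //.
        by rewrite leI2 // leIr.
      by rewrite leI2 // leIl.
    + by move=> y z [f Ff fy] yz; exists f => //; apply: le_trans yz.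
    + case=> f Ff; rewrite lex0 => /eqP f0; apply: nFx; apply: Fle Ff _.
      by rewrite -diff_eq0 diffE f0.
    + by move=> _ _; exists b => //; apply: leIl.
  - by move=> z Fz; exists z => //; apply: leIl.
  - by exists b => //; apply: leIr.
split=> // x y; split=> [Fxy|[]]; last exact: FI.
by split; apply: Fle Fxy _; [apply: leIl|apply: leIr].
Qed.

Definition stone := {u : set B | ultrafilter u}.

Definition stone_set (b : B) : set stone := [set u | sval u b].

Lemma stone_setI x y : stone_set (x `&` y)%O = stone_set x `&` stone_set y.
Proof. by apply/seteqP; split=> u /=; rewrite /stone_set /= (ultraI (svalP u)). Qed.

Lemma stone_setU x y : stone_set (x `|` y)%O = stone_set x `|` stone_set y.
Proof. by apply/seteqP; split=> u /=; rewrite /stone_set /= (ultraU (svalP u)). Qed.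

Lemma stone_setC x : stone_set (~` x)%O = ~` stone_set x.
Proof. by apply/seteqP; split=> u /=; rewrite /stone_set /= (ultraC (svalP u)). Qed.

Lemma stone_set0 : stone_set \bot%O = set0.
Proof. by apply/seteqP; split=> // u /(ultra0 (svalP u)). Qed.

Lemma stone_setT : stone_set \top%O = setT.
Proof. by apply/seteqP; split=> // u _; apply: (ultraT (svalP u)). Qed.

(** If [x] is not below [y], some ultrafilter contains [x] and the complement of [y]. *)
Lemma stone_set_inj : injective stone_set.
Proof.
suff le x y : stone_set x = stone_set y -> (x <= y)%O.
  by move=> x y xy; apply/le_anti; rewrite !le.
move=> xy; apply: contrapT => nxy.
have [|u uu] := @ultra_exists (x `&` ~` y)%O.
  by move/eqP; rewrite -diffE diff_eq0.
rewrite (ultraI uu) (ultraC uu) => -[ux uy]; apply: uy.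
have : stone_set x (exist _ u uu) by [].
by rewrite xy.
Qed.

Definition clopen : set (set stone) := range stone_set.

Lemma clopen_alg : set_algebra clopen.
Proof.
split.
- by exists \bot%O => //; apply: stone_set0.
- by move=> _ _ [x _ <-] [y _ <-]; exists (x `&` y)%O => //; apply: stone_setI.
- by move=> _ [x _ <-]; exists (~` x)%O => //; apply: stone_setC.
Qed.

Hypothesis nondegenerate : (\bot%O : B) <> \top%O.

Lemma stone_inhabited : exists u : stone, True.
Proof.
have [|u uu _] := @ultra_exists \top%O; last by exists (exist _ u uu).
by move=> /esym.
Qed.

Definition stone_base : stone := projT1 (cid stone_inhabited).

Definition stone_gen : set (set (stone * nat)) :=
  [set g | (exists b, g = [set p | stone_set b p.1]) \/
           (exists n, g = [set p | p.2 = n])].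

(* The factor [nat] is there only to make the algebra infinite. *)
Definition stone_level : level := Level (stone_base, 0%N) (generated stone_gen).

Lemma stone_level_alg : set_algebra (events stone_level).
Proof. exact: generated_alg. Qed.

(** The charge will live on the copy of index 0, so only this slice of an event counts. *)
Definition slice (S : set (stone * nat)) : set stone := [set u | S (u, 0%N)].

Lemma slice_clopen S : events stone_level S -> clopen (slice S).
Proof.
apply: (generated_preimage (h := fun u => (u, 0%N)) clopen_alg).
move=> _ [[b ->]|[n ->]]; first by exists b.
case: n => [|n]; [have := algT clopen_alg|have := alg0 clopen_alg];
  by congr clopen; apply/seteqP; split.
Qed.

Section StoneCharge.
Variables (K : realFieldType) (P : B -> K).
Hypothesis probP : probability_distribution P.

Definition stone_charge (S : set (stone * nat)) : K :=
  P (pick_in \bot%O [set b | stone_set b = slice S]).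

Lemma stone_chargeE S b : slice S = stone_set b -> stone_charge S = P b.
Proof.
move=> Sb; congr P; apply: stone_set_inj; rewrite -Sb.
by apply: (@pickP _ _ [set b | stone_set b = slice S]); exists b.
Qed.

Lemma stone_charge_charge : charge (events stone_level) stone_charge.
Proof.
split.
- by move=> S /slice_clopen[b _ /esym/stone_chargeE->]; apply: prob_ge0 probP _.
- by rewrite (@stone_chargeE _ \top%O) ?(prob1 probP) // stone_setT.
- move=> S T /slice_clopen[b _ bS] /slice_clopen[c _ cT].
  rewrite (stone_chargeE (esym bS)) (@stone_chargeE (S `&` T) (b `&` c)%O); last first.
    by rewrite stone_setI bS cT.
  rewrite (@stone_chargeE (S `\` T) (b `&` ~` c)%O); last first.
    by rewrite stone_setI stone_setC bS cT.
  have := probIU probP (b `&` c)%O (b `&` ~` c)%O.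
  rewrite -meetUr joinxC meetx1 meetACA meetxC meetx0.
  by rewrite (prob0 probP) add0r.
Qed.

End StoneCharge.
End Stone.

(** * Infinite sets are equipotent to their squares *)

Definition embeds (T U : Type) : Prop := exists f : T -> U, injective f.

Lemma embeds_trans T U V : embeds T U -> embeds U V -> embeds T V.
Proof. by move=> [f fI] [g gI]; exists (g \o f); apply: inj_comp. Qed.

Lemma sval_inj U (Q : U -> Prop) : injective (sval : {x | Q x} -> U).
Proof. by move=> [x Qx] [y Qy] /=; apply: eq_exist. Qed.

Lemma embeds_total X Y : embeds X Y \/ embeds Y X.
Proof.
pose P (R : set (X * Y)) := (forall x y y', R (x, y) -> R (x, y') -> y = y') /\
  (forall x x' y, R (x, y) -> R (x', y) -> x = x').
have [|R [[Rf Ri] Rmax]] := @Zorn_bigcup _ P.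
  move=> C CP Ctot; split=> [x y y' [R CR Rxy] [S CS Sxy]|x x' y [R CR Rxy] [S CS Sxy]];
  by have [RS|SR] := Ctot _ _ CR CS;
    [have [Sf Si] := CP _ CS; have := RS _ Rxy|have [Sf Si] := CP _ CR; have := SR _ Sxy];
    eauto.
have [tot|ntot] := pselect (forall x, exists y, R (x, y)).
  have [f fR] := choice tot; left; exists f => x x' xx'.
  by apply: Ri (fR x) _; rewrite xx'.
right; have [x0 nx0] : exists x, forall y, ~ R (x, y).
  apply: contrapT => nx; apply: ntot => x; apply: contrapT => nxy.
  by apply: nx; exists x => y Rxy; apply: nxy; exists y.
have tot y : exists x, R (x, y).
  apply: contrapT => ny.
  apply: (Rmax (R `|` [set (x0, y)])).
    split; first by move=> p; left.
    by move=> /(_ (x0, y)) /= RR; apply: ny; exists x0; apply: RR; right.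
  split=> [x z z'|x x' z].
    case=> [Rxz|[-> ->]]; case=> [Rxz'|[]].
    - exact: Rf Rxz Rxz'.
    - by move=> xx0; case: (nx0 z); rewrite -xx0.
    - by exfalso; apply: (nx0 z').
    - by move=> ->.
  case=> [Rxz|[-> ->]]; case=> [Rxz'|[]].
  - exact: Ri Rxz Rxz'.
  - by move=> _ zy; case: ny; exists x; rewrite -zy.
  - by case: ny; exists x'.
  - by move=> ->.
have [f fR] := choice tot; exists f => y y' yy'.
by apply: Rf (fR y) _; rewrite yy'.
Qed.

Section Hessenberg.
Variable T : Type.

(** [F] is the graph of an injection of [A * A] into [A], taken as a set so that inclusion orders
    such maps. *)
Record pairing (A : set T) (F : set (T * T * T)) : Prop := Pairing {
  pairing_total : forall x y, A x -> A y -> exists z, F (x, y, z);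
  pairing_field : forall x y z, F (x, y, z) -> [/\ A x, A y & A z];
  pairing_fun : forall p z z', F (p, z) -> F (p, z') -> z = z';
  pairing_inj : forall p p' z, F (p, z) -> F (p', z) -> p = p'
}.

Let diag (F : set (T * T * T)) : set T := [set x | exists z, F (x, x, z)].

Let pairing_diag A F : pairing A F -> diag F = A.
Proof.
move=> pA; apply/seteqP; split=> [x [z /(pairing_field pA)[]//]|x Ax].
exact: (pairing_total pA).
Qed.

Lemma pairing_bigcup (C : set (set (T * T * T))) :
  (forall F, C F -> exists A, pairing A F) -> total_on C subset ->
  exists A, pairing A (\bigcup_(F in C) F).
Proof.
move=> CP Ctot; have CD F : C F -> pairing (diag F) F.
  by move=> CF; have [A pA] := CP _ CF; rewrite (pairing_diag pA).
have Ctot2 F G : C F -> C G -> exists H, [/\ C H, F `<=` H & G `<=` H].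
  by move=> CF CG; have [FG|GF] := Ctot _ _ CF CG; [exists G|exists F]; split.
have dS F G : F `<=` G -> diag F `<=` diag G.
  by move=> FG x [z Fz]; exists z; apply: FG.
exists (\bigcup_(F in C) diag F); split.
- move=> x y [F CF Fx] [G CG Gy]; have [H [CH FH GH]] := Ctot2 _ _ CF CG.
  have [z Hz] := pairing_total (CD _ CH) (dS _ _ FH _ Fx) (dS _ _ GH _ Gy).
  by exists z, H.
- by move=> x y z [F CF /(pairing_field (CD _ CF))[Fx Fy Fz]]; split; exists F.
- move=> p z z' [F CF Fz] [G CG Gz]; have [H [CH FH GH]] := Ctot2 _ _ CF CG.
  exact: (pairing_fun (CD _ CH) (FH _ Fz) (GH _ Gz)).
- move=> p p' z [F CF Fz] [G CG Gz]; have [H [CH FH GH]] := Ctot2 _ _ CF CG.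
  exact: (pairing_inj (CD _ CH) (FH _ Fz) (GH _ Gz)).
Qed.

(** [h] makes a copy of [A] outside [A]. The new pairs of the union are coded in [A], then sent into
    the copy by [h], where they avoid the old values. *)
Lemma pairing_extend A F (a0 a1 : T) (h : T -> T) : pairing A F ->
  A a0 -> A a1 -> a0 <> a1 ->
  (forall x, A x -> ~ A (h x)) ->
  (forall x y, A x -> A y -> h x = h y -> x = y) ->
  exists F', [/\ exists A', pairing A' F', F `<=` F' & ~ (F' `<=` F)].
Proof.
move=> pA Aa0 Aa1 a01 hA hI.
have /choice[f fF] (p : T * T) : exists z, A p.1 -> A p.2 -> F (p, z).
  case: p => x y; have [[Ax Ay]|nxy] := pselect (A x /\ A y); last first.
    by exists x => /= Ax Ay; case: nxy.
  by have [z Fz] := pairing_total pA Ax Ay; exists z.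
have fA x y : A x -> A y -> A (f (x, y)).
  by move=> Ax Ay; have [] := pairing_field pA (fF (x, y) Ax Ay).
have fI x y x' y' : A x -> A y -> A x' -> A y' -> f (x, y) = f (x', y') ->
    x = x' /\ y = y'.
  move=> Ax Ay Ax' Ay' E; have := fF (x, y) Ax Ay; rewrite E => Fxy.
  by have [-> ->] := pairing_inj pA Fxy (fF (x', y') Ax' Ay').
pose A' x := A x \/ exists2 y, A y & x = h y.
(* An element [x] of [A'] amounts to an element [c x] of [A] and a tag [t x] telling the two copies
   apart. *)
have [c [t ct]] : exists c t : T -> T, forall x, A' x ->
    [/\ A (c x), A (t x), A x -> t x = a0 & ~ A x -> t x = a1] /\
    (A x -> c x = x) /\ (~ A x -> x = h (c x)).
  have /choice[g gP] (x : T) : exists g : T * T, A' x ->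
      [/\ A g.1, A g.2, A x -> g.2 = a0 & ~ A x -> g.2 = a1] /\
      (A x -> g.1 = x) /\ (~ A x -> x = h g.1).
    have [Ax|nAx] := pselect (A x); first by exists (x, a0).
    have [A'x|nA'x] := pselect (A' x); last by exists (x, x).
    by case: A'x => // -[y Ay xhy]; exists (y, a1).
  by exists (fun x => (g x).1), (fun x => (g x).2).
have ctI x y : A' x -> A' y -> c x = c y -> t x = t y -> x = y.
  move=> /ct[[cx tx tx0 tx1] [cAx cnx]] /ct[[cy ty ty0 ty1] [cAy cny]] cxy txy.
  have [Ax|nAx] := pselect (A x); have [Ay|nAy] := pselect (A y).
  - by rewrite -cAx // cxy cAy.
  - by case: a01; rewrite -tx0 // txy ty1.
  - by case: a01; rewrite -ty0 // -txy tx1.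
  - by rewrite cnx // cxy -cny.
pose k (p : T * T) := f (f (c p.1, c p.2), f (t p.1, t p.2)).
have kA x y : A' x -> A' y -> A (k (x, y)).
  by move=> /ct[[? ? _ _] _] /ct[[? ? _ _] _]; apply: (fA); apply: fA.
have kI x y x' y' : A' x -> A' y -> A' x' -> A' y' -> k (x, y) = k (x', y') ->
    (x, y) = (x', y').
  move=> A'x A'y A'x' A'y'.
  have [[cx tx _ _] _] := ct _ A'x; have [[cy ty _ _] _] := ct _ A'y.
  have [[cx' tx' _ _] _] := ct _ A'x'; have [[cy' ty' _ _] _] := ct _ A'y'.
  case/fI; [exact: fA|exact: fA|exact: fA|exact: fA|].
  case/fI => // ccx ccy; case/fI => // ttx tty.
  by rewrite (ctI x x') // (ctI y y').
pose F' (q : T * T * T) := F q \/ [/\ A' q.1.1, A' q.1.2,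
  ~ (A q.1.1 /\ A q.1.2) & q.2 = h (k q.1)].
exists F'; split.
- exists A'; split.
  + move=> x y A'x A'y; have [[Ax Ay]|nA] := pselect (A x /\ A y).
      by have [z Fz] := pairing_total pA Ax Ay; exists z; left.
    by exists (h (k (x, y))); right; split.
  + move=> x y z [/(pairing_field pA)[Ax Ay Az]|[/= A'x A'y _ ->]].
      by split; left.
    by split=> //; right; exists (k (x, y)) => //; apply: kA.
  + move=> [x y] z z' [Fz|[/= _ _ nA ->]] [Fz'|[/= _ _ nA' ->]] //.
    * exact: (pairing_fun pA Fz Fz').
    * by case: nA'; have [] := pairing_field pA Fz.
    * by case: nA; have [] := pairing_field pA Fz'.
  + move=> [x y] [x' y'] z [Fz|[/= A'x A'y nA zE]] [Fz'|[/= A'x' A'y' nA' zE']].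
    * exact: (pairing_inj pA Fz Fz').
    * have [_ _] := pairing_field pA Fz; rewrite zE' => Ahk.
      by case: (hA _ (kA _ _ A'x' A'y') Ahk).
    * have [_ _] := pairing_field pA Fz'; rewrite zE => Ahk.
      by case: (hA _ (kA _ _ A'x A'y) Ahk).
    * apply: kI => //; apply: hI; [exact: kA|exact: kA|].
      by rewrite -zE zE'.
- by move=> q; left.
- move=> /(_ (h a0, a0, h (k (h a0, a0)))) sub.
  have A'h : A' (h a0) by right; exists a0.
  have A'0 : A' a0 by left.
  have F'h : F' (h a0, a0, h (k (h a0, a0))).
    by right; split=> // -[/= Ah _]; apply: hA Aa0 Ah.
  by have [Ah _ _] := pairing_field pA (sub F'h); apply: hA Aa0 Ah.
Qed.

(** Take a maximal pairing, on a set [A], above that of a copy of [nat]. If [A] embedded in its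
    complement, it could be extended. So the complement embeds in [A]; with tags, [T] embeds in
    [A * A], hence [T * T] in [A]. *)
Theorem embeds_square : embeds nat T -> embeds (T * T) T.
Proof.
move=> [i iI]; pose pn (p : nat * nat) : nat := choice.pickle p.
have pnI : injective pn by apply: pcan_inj choice.pickleK.
pose F0 (q : T * T * T) := exists m n, q = (i m, i n, i (pn (m, n))).
have F0P : pairing (range i) F0.
  split.
  - by move=> _ _ [m _ <-] [n _ <-]; exists (i (pn (m, n))), m, n.
  - by move=> x y z [m [n [-> -> ->]]]; split; [exists m|exists n|eexists].
  - by move=> p z z' [m [n [-> ->]]] [m' [n' [/iI -> /iI -> ->]]].
  - by move=> p p' z [m [n [-> ->]]] [m' [n' [-> /iI/pnI[-> ->]]]].
(* The second clause is vacuous for the empty graph, the union of the empty chain; a maximal [F] is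
   not empty, as [F0] would be larger. *)
pose P F := (exists A, pairing A F) /\ forall q, F q -> F0 `<=` F.
have [|F [[[A pA] F0F] Fmax]] := @Zorn_bigcup _ P.
  move=> C CP Ctot; split; first by apply: pairing_bigcup => // F /CP[].
  move=> q [F CF Fq] q' /((CP _ CF).2 q Fq) Fq'; by exists F.
have {}F0F : F0 `<=` F.
  apply: contrapT => nF; apply: (Fmax F0); last first.
    by split; [exists (range i)|move=> q _].
  by split=> // q Fq; exfalso; apply: nF; apply: F0F Fq.
have Ai n : A (i n).
  have /F0F/(pairing_field pA)[]// : F0 (i n, i n, i (pn (n, n))) by exists n, n.
have i01 : i 0%N <> i 1%N by move/iI.
have [[h hI]|[h hI]] := embeds_total {x | A x} {x | ~ A x}.
  pose h' x := if pselect (A x) is left Ax then sval (h (exist _ x Ax)) else x.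
  have h'E x (Ax : A x) : h' x = sval (h (exist _ x Ax)).
    by rewrite /h'; case: (pselect (A x)) => // Ax'; rewrite (Prop_irrelevance Ax' Ax).
  have [|x y Ax Ay|F' [[A' pA'] FF' nF'F]] :=
    pairing_extend (h := h') pA (Ai 0%N) (Ai 1%N) i01.
  - by move=> x Ax; rewrite h'E; exact: (svalP (h _)).
  - by rewrite !h'E => /sval_inj/hI[].
  - exfalso; apply: (Fmax F'); first by split.
    by split; [exists A'|move=> _ _ q /F0F/FF'].
have /choice[f fF] (p : T * T) : exists z, A p.1 -> A p.2 -> F (p, z).
  case: p => x y; have [[Ax Ay]|nxy] := pselect (A x /\ A y); last first.
    by exists x => /= Ax Ay; case: nxy.
  by have [z Fz] := pairing_total pA Ax Ay; exists z.
have fA p : A p.1 -> A p.2 -> A (f p).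
  by case: p => x y Ax Ay; have [] := pairing_field pA (fF (x, y) Ax Ay).
have fI p p' : A p.1 -> A p.2 -> A p'.1 -> A p'.2 -> f p = f p' -> p = p'.
  move=> A1 A2 A1' A2' E; have := fF p A1 A2; rewrite E => Fp.
  exact: (pairing_inj pA Fp (fF p' A1' A2')).
pose g x := if pselect (A x) is right nAx
  then (sval (h (exist _ x nAx)), i 1%N) else (x, i 0%N).
have gA x : A (g x).1 /\ A (g x).2.
  by rewrite /g; case: pselect => //= nAx; split=> //; exact: (svalP (h _)).
have gI : injective g.
  move=> x y; rewrite /g; case: pselect => Ax; case: pselect => Ay.
  - by case.
  - by case=> _ /i01.
  - by case=> _ /esym/i01.
  - by case=> /sval_inj/hI[].
exists (fun p => f (f (g p.1), f (g p.2))) => -[x y] [x' y'] /= E.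
have [gx1 gx2] := gA x; have [gy1 gy2] := gA y.
have [gx1' gx2'] := gA x'; have [gy1' gy2'] := gA y'.
have [fgx fgy] : f (g x) = f (g x') /\ f (g y) = f (g y').
  by have [] := fI (f (g x), f (g y)) (f (g x'), f (g y')) (fA _ gx1 gx2)
    (fA _ gy1 gy2) (fA _ gx1' gx2') (fA _ gy1' gy2') E.
by congr (_, _); apply: gI; apply: fI.
Qed.

Theorem embeds_seq : embeds nat T -> embeds (seq T) T.
Proof.
move=> natT; have [p pI] := embeds_square natT; have [i iI] := natT.
pose code := foldr (fun x y => p (x, y)) (i 0%N).
(* The length is recorded because the end marker [i 0%N] may itself be a value of [p]. *)
exists (fun s => p (i (size s), code s)) => s s' /pI[/iI].
elim: s s' => [|x s IH] [|x' s'] //= [ss'] /pI[-> cc'].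
by rewrite (IH s').
Qed.

End Hessenberg.

(** * Cardinality of the limit algebra *)

(** Bounds a cardinality by codes that need not be unique, as an event has many presentations. *)
Definition covers (T U : Type) (A : set U) : Prop := exists g : T -> U, A `<=` range g.

Section Codes.
Variable C : eqType.
Hypotheses (seqC : embeds (seq C) C) (natC : embeds nat C).

Lemma embeds_list A : embeds A C -> embeds (seq A) C.
Proof.
move=> [f fI]; apply: embeds_trans seqC; exists (map f).
exact: inj_map.
Qed.

Lemma embeds_prod A B : embeds A C -> embeds B C -> embeds (A * B) C.
Proof.
move=> [f fI] [g gI]; apply: embeds_trans seqC.
by exists (fun p => [:: f p.1; g p.2]) => -[x y] [x' y'] /= [/fI-> /gI->].
Qed.

Lemma embeds_sum A B : embeds A C -> embeds B C -> embeds (A + B) C.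
Proof.
move=> [f fI] [g gI]; apply: embeds_trans seqC.
exists (fun s => match s with inl x => [:: f x] | inr y => [:: g y; g y] end).
by move=> [x|y] [x'|y'] //= [] => [/fI|/gI] ->.
Qed.

Lemma embeds_option A : embeds A C -> embeds (option A) C.
Proof.
move=> [f fI]; apply: embeds_trans seqC; exists (fun s => seq_of_opt (omap f s)).
by move=> [x|] [x'|] //= [/fI->].
Qed.

Lemma embeds_bool : embeds bool C.
Proof. by apply: embeds_trans natC; exists nat_of_bool; case=> -[]. Qed.

Lemma covers_embeds T (t0 : T) U (A : set U) : embeds T C -> covers T A -> covers C A.
Proof.
move=> [f fI] [g gA]; exists (fun c => g (pick_in t0 [set t | f t = c])) => a /gA[t _ <-].
exists (f t) => //; congr g; apply: fI.
by apply: (@pickP _ _ [set u | f u = f t]); exists t.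
Qed.

Lemma embeds_sub U (A : set U) : covers C A -> embeds {a | A a} C.
Proof.
move=> [g gA]; have /choice[f fP] (a : {a | A a}) : exists c, g c = sval a.
  by have [c _ ca] := gA _ (svalP a); exists c.
by exists f => a b ab; apply: sval_inj; rewrite -!fP ab.
Qed.

(** An event is coded by a finite list of generators and the truth patterns that its points realise
    on them. *)
Lemma covers_generated U (G : set (set U)) : covers C G -> covers C (generated G).
Proof.
move=> [g gG].
apply: (@covers_embeds (seq C * seq (seq bool)) ([::], [::])).
  by apply: embeds_prod seqC _; do 2!apply: embeds_list; apply: embeds_bool.
pose signs (cs : seq C) y := [seq `[< g c y >] | c <- cs].
exists (fun p => [set y | signs p.1 y \in p.2]) => e [D DG De].
have [cs csD] : exists cs, D = map g cs.
  elim: D DG {De} => [|h D IH] DG; first by exists [::].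
  have [|cs ->] := IH; first by move=> k kD; apply: DG; rewrite in_cons kD orbT.
  have [c _ <-] := gG _ (DG h (mem_head _ _)).
  by exists (c :: cs).
pose pats : seq (seq bool) := [seq val t | t : (size cs).-tuple bool in
  [pred t : (size cs).-tuple bool | `[< exists2 y, e y & signs cs y = val t >]]].
exists (cs, pats) => //=; apply/seteqP; split=> y /=.
  case/fintype.imageP => t; rewrite inE => -[z ez zt] yt.
  apply: (De z y) => // h; rewrite csD => /mapP[c cC ->].
  have : signs cs z = signs cs y by rewrite zt yt.
  move/eq_in_map => /(_ c cC) E; split=> gc; apply/asboolP.
    by rewrite -E; apply/asboolP.
  by rewrite E; apply/asboolP.
move=> ey; apply/fintype.imageP.
have sz : size (signs cs y) == size cs by rewrite size_map.
by exists (Tuple sz) => //; rewrite inE; exists y.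
Qed.

(** Valid coordinates are indexed by events, which already have codes in [C]. *)
Lemma covers_next L : covers C (events L) -> covers C (events (next L)).
Proof.
move=> [g gL]; apply: covers_generated; have [i _] := natC.
apply: (@covers_embeds (option (C * nat) * C) (None, i 0%N)).
  apply: embeds_prod; last by exists id.
  by apply: embeds_option; apply: embeds_prod natC; exists id.
exists (fun p => cyl (omap (fun k => (g k.1, k.2)) p.1 : coord L) (g p.2)).
move=> _ [j [a [vj /gL[c _ <-] ->]]].
case: j vj => [[x n]|] /= vj; last by exists (None, c).
by have [c' _ <-] := gL _ vj; exists (Some (c', n), c).
Qed.

Lemma covers_limit L : covers C (events L) -> covers C (@limit_events L).
Proof.
move=> cL; have cov n : covers C (events (lvl L n)).
  by elim: n => // n IH; apply: covers_next.
have [i _] := natC; apply: (@covers_embeds (nat * C) (0%N, i 0%N)).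
  by apply: embeds_prod natC _; exists id.
exists (fun p => pr p.1 @^-1` (projT1 (cid (cov p.1)) p.2)) => _ [n [a La ->]].
by have [c _ <-] := projT2 (cid (cov n)) a La; exists (n, c).
Qed.

Lemma covers_stone d (B : ctbDistrLatticeType d)
    (nondegenerate : (\bot%O : B) <> \top%O) :
  embeds B C -> covers C (events (stone_level nondegenerate)).
Proof.
move=> BC; apply: covers_generated.
apply: (@covers_embeds (B + nat) (inr 0%N)); first exact: embeds_sum.
exists (fun s => match s with
  | inl b => [set p | stone_set b p.1]
  | inr n => [set p | p.2 = n]
  end) => _ [[b ->]|[n ->]]; [by exists (inl b)|by exists (inr n)].
Qed.

End Codes.

(** * Set algebras as Boolean algebras *)

Section SetLattice.
Variables (d : Order.disp_t) (Y : Type) (A : set (set Y)).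

(** [algA] is a parameter of the type so that the instances below can recover the closure proofs. *)
Definition set_lattice (algA : set_algebra A) : Type := {S : set Y | A S}.

Variable algA : set_algebra A.
Notation E := (set_lattice algA).
Implicit Types a b c : E.

HB.instance Definition _ := gen_eqMixin E.
HB.instance Definition _ := gen_choiceMixin E.

Definition sl_meet a b : E := exist _ _ (algI algA (svalP a) (svalP b)).
Definition sl_join a b : E := exist _ _ (algU algA (svalP a) (svalP b)).
Definition sl_compl a : E := exist _ _ (algC algA (svalP a)).
Definition sl_bot : E := exist _ _ (alg0 algA).
Definition sl_top : E := exist _ _ (algT algA).
Definition sl_le a b := `[< sval a `<=` sval b >].
Definition sl_lt a b := (b != a) && sl_le a b.

Lemma sl_le_def a b : sl_le a b = (sl_meet a b == a).
Proof.
apply/asboolP/eqP => [/setIidl ab|<-]; first exact: sval_inj.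
by move=> y [].
Qed.

Lemma sl_meetC : commutative sl_meet.
Proof. by move=> a b; apply: sval_inj; apply: setIC. Qed.

Lemma sl_joinC : commutative sl_join.
Proof. by move=> a b; apply: sval_inj; apply: setUC. Qed.

Lemma sl_meetA : associative sl_meet.
Proof. by move=> a b c; apply: sval_inj; apply: setIA. Qed.

Lemma sl_joinA : associative sl_join.
Proof. by move=> a b c; apply: sval_inj; apply: setUA. Qed.

Lemma sl_joinKI b a : sl_meet a (sl_join a b) = a.
Proof. by apply: sval_inj; apply/setIidl => y; left. Qed.

Lemma sl_meetKU b a : sl_join a (sl_meet a b) = a.
Proof. by apply: sval_inj; apply/setUidl => y []. Qed.

Lemma sl_meetUl : left_distributive sl_meet sl_join.
Proof. by move=> a b c; apply: sval_inj; apply: setIUl. Qed.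

Lemma sl_meetxx : idempotent_op sl_meet.
Proof. by move=> a; apply: sval_inj; apply: setIid. Qed.

HB.instance Definition _ := Order.isMeetJoinDistrLattice.Build d E
  sl_le_def (fun _ _ => erefl) sl_meetC sl_joinC sl_meetA sl_joinA
  sl_joinKI sl_meetKU sl_meetUl sl_meetxx.

Lemma sl_le0 a : (sl_bot <= a)%O.
Proof. by apply/asboolP => y. Qed.

Lemma sl_le1 a : (a <= sl_top)%O.
Proof. by apply/asboolP => y. Qed.

HB.instance Definition _ := Order.hasBottom.Build d E sl_le0.
HB.instance Definition _ := Order.hasTop.Build d E sl_le1.

Lemma sl_joinxC a : (a `|` sl_compl a)%O = \top%O.
Proof. by apply: sval_inj; apply: setUv. Qed.

Lemma sl_meetxC a : (a `&` sl_compl a)%O = \bot%O.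
Proof. by apply: sval_inj; apply: setICr. Qed.

HB.instance Definition _ := Order.TBDistrLattice_hasComplement.Build d E
  sl_joinxC sl_meetxC.

End SetLattice.

(** * The Bayesian extension *)

Lemma embeds_card_le T U : embeds T U -> ([set: T] #<= [set: U])%card.
Proof.
move=> [f fI]; have fT : {in [set: T] &, injective f} by move=> x y _ _; apply: fI.
by rewrite -(card_le_eql (inj_card_eq fT)); apply: card_leT.
Qed.

Section Extension.
Variables (d : Order.disp_t) (B : ctbDistrLatticeType d).
Hypothesis nondegenerate : (\bot%O : B) <> \top%O.

Let L := stone_level nondegenerate.
Let algL : set_algebra (events L) := stone_level_alg nondegenerate.

Definition bayes : ctbDistrLatticeType d := set_lattice (limit_alg algL).
Implicit Types x y : bayes.

Definition bayes_cond x y : bayes :=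
  exist _ _ (limit_retract_events algL (svalP x) (svalP y)).

Lemma stone_set_event b :
  limit_events ((fun f : limit L => f.1) @^-1` [set p | stone_set b p.1]).
Proof.
exists 0%N, [set p | stone_set b p.1] => //.
by apply: sub_generated; left; exists b.
Qed.

Definition bayes_embed b : bayes := exist _ _ (stone_set_event b).

Lemma bayes_botP x : x <> \bot%O -> sval x !=set0.
Proof.
by move=> x0; apply: contrapT => /nonemptyPn xe; apply: x0; apply: sval_inj.
Qed.

Lemma bayes_algebra : bayesian_algebra bayes_cond.
Proof.
split.
(* Preimages commute with the Boolean operations by computation. *)
- by move=> x; split=> *; apply: sval_inj.
- move=> x y /asboolP xy; have [->|x0] := pselect (x = \bot%O); first by right.
  left; apply: sval_inj; apply/seteqP; split=> // f _.
  by apply: xy; apply: (limit_retract_in algL) (svalP x) (bayes_botP x0).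
- move=> x y; apply: sval_inj; apply/seteqP; split=> f [xf yf]; split=> //.
    by move: yf; rewrite /= (limit_retract_id algL (svalP x) xf).
  by rewrite /= (limit_retract_id algL (svalP x) xf).
- move=> x y; apply: sval_inj; apply/seteqP.
  have E f : limit_retract (sval x) (limit_retract (sval x) f) = limit_retract (sval x) f.
    have [x0|x0] := pselect (sval x !=set0).
      by apply: (limit_retract_id algL (svalP x)); apply: limit_retract_in (svalP x) x0.
    by rewrite /limit_retract; case: pselect => // -[].
  by split=> f /=; rewrite E.
- move=> x y; apply: sval_inj; apply/seteqP.
  have E f := limit_retractC algL f (svalP x).
  by split=> f /=; rewrite E.
Qed.

Lemma bayes_embed_morph : boolean_morphism bayes_embed.
Proof.
split=> [b c|b c|b||]; apply: sval_inj; apply/seteqP; split=> f;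
  rewrite /= ?stone_setI ?stone_setU ?stone_setC ?stone_set0 ?stone_setT //.
Qed.

Lemma limit_surj (p : carrier L) : exists f : limit L, f.1 = p.
Proof. by exists (p, fun n => (base (lvl L n.+1)).2). Qed.

Lemma bayes_embed_inj : injective bayes_embed.
Proof.
move=> b c /(congr1 sval) /= bc; apply: stone_set_inj; apply/seteqP.
have E u : stone_set b u <-> stone_set c u.
  have [f fu] := limit_surj (u, 0%N).
  have := congr1 (fun S : set (limit L) => S f) bc.
  by rewrite /= fu /= => ->.
by split=> u /E.
Qed.

Lemma bayes_extension : bayesian_extension B bayes_cond.
Proof.
split; first exact: bayes_algebra.
exists bayes_embed; split; [exact: bayes_embed_morph|exact: bayes_embed_inj|].
move=> K P probP; have chP := stone_charge_charge nondegenerate probP.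
exists (fun x => limit_charge algL chP (sval x)).
have chQ := limit_charge_charge algL chP; split; last first.
  move=> b; rewrite /= -[_ @^-1` _]/(pr 0 @^-1` _) limit_chargeE.
    by apply: stone_chargeE; apply/seteqP; split.
  by apply: sub_generated; left; exists b.
split; last by move=> x y; apply: limit_charge_cond (svalP x) (svalP y).
split.
- by move=> x; apply: (charge_ge0 chQ); apply: svalP.
- exact: (additive_on0 (alg0 (limit_alg algL)) (charge_add chQ)).
- exact: (chargeT chQ).
- move=> x y.
  exact: (additive_onU (limit_alg algL) (charge_add chQ) (svalP x) (svalP y)).
Qed.

Lemma bayes_infinite : embeds nat bayes.
Proof.
have ev n : limit_events ((fun f : limit L => f.1) @^-1` [set p | p.2 = n]).
  exists 0%N, [set p | p.2 = n] => //.
  by apply: sub_generated; right; exists n.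
exists (fun n => exist _ _ (ev n) : bayes) => m n /(congr1 sval) /= mn.
have [f fu] := limit_surj (stone_base nondegenerate, m).
have := congr1 (fun S : set (limit L) => S f) mn.
by rewrite /= fu /= => <-.
Qed.

Lemma bayes_card : card_eq_max bayes B nat.
Proof.
have BE : embeds B bayes by exists bayes_embed; apply: bayes_embed_inj.
split; [exact: embeds_card_le|exact: embeds_card_le bayes_infinite|].
(* Any infinite type of codes into which [B] embeds is an upper bound; the larger of [B] and [nat]
   is one. *)
have H (C : eqType) : embeds nat C -> embeds B C -> embeds bayes C.
  move=> natC BC; have seqC := embeds_seq natC.
  exact: (embeds_sub (covers_limit seqC natC (covers_stone seqC natC _ BC))).
have [natB|Bnat] := embeds_total nat B; [left|right];
  apply/card_eqPle; split; apply: embeds_card_le => //.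
- by apply: H => //; exists id.
- by apply: H => //; exists id.
- exact: bayes_infinite.
Qed.

End Extension.

Theorem theorem3 (d : Order.disp_t) (B : ctbDistrLatticeType d)
    (nondegenerate : (\bot%O : B) <> \top%O) :
  exists (E : ctbDistrLatticeType d) (cond : E -> E -> E),
    bayesian_extension B cond /\ card_eq_max E B nat.
Proof.
exists (bayes nondegenerate), (@bayes_cond _ _ nondegenerate).
by split; [apply: bayes_extension|apply: bayes_card].
Qed.
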